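(* The triple $(P,\delta,E)$ is a submonad of the monad $(V,\delta,\mathcal{E})$ on the category $\mathsf{Top}$ of all topological spaces and continuous maps. That is, $(P,\delta,E)$ is a monad on $\mathsf{Top}$, and the inclusions $\iota_X : PX \hookrightarrow VX$, sending a $\tau$-smooth Borel probability measure to its restriction to open sets, are the components of a morphism of monads $\iota : (P,\delta,E) \to (V,\delta,\mathcal{E})$.
   Context: Let $\mathcal{O}(X)$ be the lattice of open subsets of a topological space $X$. A directed net $(U_\lambda)_{\lambda\in\Lambda}$ in a poset is a monotone family indexed by a directed set. $[0,\infty]$ carries the upper topology, whose open sets are $\varnothing$, $[0,\infty]$ and $(r,\infty]$; $[0,\infty]^X$ denotes the set of continuous (i.e. lower semicontinuous) maps $X\to[0,\infty]$ with pointwise order and algebra, with $0\cdot\infty=0$. The monad $V$. A continuous valuation on $X$ is a map $\nu:\mathcal{O}(X)\to[0,\infty]$ with $\nu(\varnothing)=0$, $\nu(U\cup W)+\nu(U\cap W)=\nu(U)+\nu(W)$, and $\nu(\bigcup_\lambda U_\lambda)=\sup_\lambda\nu(U_\lambda)$ for every directed net of open sets. For a simple lower semicontinuous $f=\sum_{i=1}^n r_i 1_{U_i}$ ($U_i$ open, $r_i\in(0,\infty]$) put $\int f\,d\nu=\sum_i r_i\nu(U_i)$, and for $g\in[0,\infty]^X$ put $\int g\,d\nu=\sup\{\int f\,d\nu : f \text{ simple lower semicontinuous}, f\le g\}$; write $\langle\nu,g\rangle=\int g\,d\nu$. Via $\nu\mapsto\langle\nu,-\rangle$, continuous valuations correspond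 bijectively to $[0,\infty]$-linear maps $[0,\infty]^X\to[0,\infty]$ preserving directed suprema. $VX$ is the set of continuous valuations on $X$ with the weakest topology making $\nu\mapsto\langle\nu,g\rangle\in[0,\infty]$ continuous for every $g\in[0,\infty]^X$. For continuous $f:X\to Y$, $f_*:VX\to VY$ is $(f_*\nu)(U)=\nu(f^{-1}(U))$. The unit $\delta:X\to VX$ is $\delta(x)(U)=1_U(x)$. The multiplication $\mathcal{E}:VVX\to VX$ is defined by $\langle\mathcal{E}\xi,g\rangle=\langle\xi,\ \rho\mapsto\langle\rho,g\rangle\rangle$ for $g\in[0,\infty]^X$. $(V,\delta,\mathcal{E})$ is a monad on $\mathsf{Top}$. The data of $P$. A Borel measure $m$ on $X$ is $\tau$-smooth if $m(\bigcup_\lambda U_\lambda)=\sup_\lambda m(U_\lambda)$ for every directed net of open sets. $PX$ is the set of $\tau$-smooth Borel probability measures on $X$, regarded as a subset of $VX$ by restriction of measures to open sets and equipped with the subspace topology (equivalently, the weakest topology making $p\mapsto\int f\,dp$ continuous for all lower semicontinuous $f:X\to[0,\infty]$). For continuous $f:X\to Y$, $f_*:PX\to PY$ is the pushforward $(f_*p)(B)=p(f^{-1}(B))$. $\delta:X\to PX$ sends $x$ to the Dirac measure at $x$. $E:PPX\to PX$ is $(E\mu)(A)=\int_{PX}p(A)\,d\mu(p)$ for Borel $A\subseteq X$. A morphism of monads $(T,\eta,\mu)\to(T',\eta',\mu')$ on the same category is a natural transformation $\alpha:T\Rightarrow T'$ with $\alpha_X\circ\eta_X=\eta'_X$ and $\alpha_X\circ\mu_X=\mu'_X\circ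 T'(\alpha_X)\circ\alpha_{TX}$ for all $X$. *)

(* Defs.v *)
From HB Require Import structures.
From mathcomp Require Import all_boot all_order all_algebra.
From mathcomp Require Import all_classical all_reals all_analysis.

Set Implicit Arguments.
Unset Strict Implicit.
Unset Printing Implicit Defensive.

Import Order.TTheory GRing.Theory Num.Theory.
Import numFieldNormedType.Exports.

Local Open Scope classical_set_scope.
Local Open Scope ring_scope.
Local Open Scope ereal_scope.

(** The objects of the category are all topological spaces: a [topologicalType] may be
    empty and satisfies no separation axiom. *)

Record monad (T : topologicalType -> topologicalType) := Monad {
  monad_fmap : forall X Y : topologicalType,
    continuousType X Y -> continuousType (T X) (T Y);
  monad_unit : forall X : topologicalType, continuousType X (T X);
  monad_mult : forall X : topologicalType, continuousType (T (T X)) (T X);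
  monad_fmap_id : forall X : topologicalType,
    monad_fmap (idfun : continuousType X X) =1 idfun;
  monad_fmap_comp : forall (X Y Z : topologicalType)
      (f : continuousType X Y) (g : continuousType Y Z),
    monad_fmap (g \o f : continuousType X Z) =1 monad_fmap g \o monad_fmap f;
  monad_unit_natural : forall (X Y : topologicalType) (f : continuousType X Y),
    monad_fmap f \o monad_unit X =1 monad_unit Y \o f;
  monad_mult_natural : forall (X Y : topologicalType) (f : continuousType X Y),
    monad_fmap f \o monad_mult X =1 monad_mult Y \o monad_fmap (monad_fmap f);
  monad_mult_unit : forall X : topologicalType,
    monad_mult X \o monad_unit (T X) =1 idfun;
  monad_mult_fmap_unit : forall X : topologicalType,
    monad_mult X \o monad_fmap (monad_unit X) =1 idfun;
  monad_mult_mult : forall X : topologicalType,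
    monad_mult X \o monad_mult (T X) =1
    monad_mult X \o monad_fmap (monad_mult X) }.

Record monad_morphism (T T' : topologicalType -> topologicalType)
    (M : monad T) (M' : monad T')
    (alpha : forall X : topologicalType, continuousType (T X) (T' X)) : Prop :=
  MonadMorphism {
  morphism_natural : forall (X Y : topologicalType) (f : continuousType X Y),
    alpha Y \o monad_fmap M f =1 monad_fmap M' f \o alpha X;
  morphism_unit : forall X : topologicalType,
    alpha X \o monad_unit M X =1 monad_unit M' X;
  morphism_mult : forall X : topologicalType,
    alpha X \o monad_mult M X =1
    monad_mult M' X \o monad_fmap M' (alpha X) \o alpha (T X) }.

Definition directed (I : Type) (le : I -> I -> Prop) : Prop :=
  [/\ inhabited I,
      forall i, le i i,
      forall i j k, le i j -> le j k -> le i k &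
      forall i j, exists2 k, le i k & le j k].

Definition directed_open_net (X : topologicalType) (I : Type)
    (le : I -> I -> Prop) (U : I -> set X) : Prop :=
  [/\ directed le,
      forall i, open (U i) &
      forall i j, le i j -> U i `<=` U j].

(** A map defined on the open sets only is encoded as a map on all sets that is
    0 elsewhere, so that Leibniz equality is equality on open sets. *)
Record valuation (R : realType) (X : topologicalType) := Valuation {
  valuation_fun :> set X -> \bar R;
  valuation_nopen : forall U, ~ open U -> valuation_fun U = 0;
  valuation_ge0 : forall U, 0 <= valuation_fun U;
  valuation0 : valuation_fun set0 = 0;
  valuation_modular : forall U W, open U -> open W ->
    valuation_fun (U `|` W) + valuation_fun (U `&` W) =
    valuation_fun U + valuation_fun W;
  valuation_directed : forall (I : Type) (le : I -> I -> Prop) (U : I -> set X),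
    directed_open_net le U ->
    valuation_fun (\bigcup_i U i) =
    ereal_sup (range (fun i => valuation_fun (U i))) }.

Lemma valuationP (R : realType) (X : topologicalType) (nu rho : valuation R X) :
  (forall U, open U -> nu U = rho U) -> nu = rho.
Proof.
move=> h; have fE : valuation_fun nu = valuation_fun rho.
  apply/funext => U; have [oU|nU] := pselect (open U); first exact: h.
  by rewrite !valuation_nopen.
case: nu rho fE {h} => [f a b c d e] [g a' b' c' d' e'] /= fg.
by subst g; congr Valuation; exact: Prop_irrelevance.
Qed.

(** The elements of [0,oo]^X: by [lower_semicontinuousP], continuity for the
    upper topology on [0,oo] is [lower_semicontinuous]. *)
Definition lsc_nneg (R : realType) (X : topologicalType) : set (X -> \bar R) :=
  [set g | (forall x, 0 <= g x) /\ lower_semicontinuous g].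

Definition vint (R : realType) (X : topologicalType) (nu : set X -> \bar R)
    (g : X -> \bar R) : \bar R :=
  ereal_sup [set s | exists n (r : 'I_n -> \bar R) (U : 'I_n -> set X),
    [/\ forall i, 0 < r i,
        forall i, open (U i),
        forall x, \sum_(i < n) r i * (\1_(U i) x)%:E <= g x &
        s = \sum_(i < n) r i * nu (U i)]].

HB.instance Definition _ (R : realType) (X : topologicalType) :=
  gen_eqMixin (valuation R X).
HB.instance Definition _ (R : realType) (X : topologicalType) :=
  gen_choiceMixin (valuation R X).

(** Preimages of the subbasic open sets ]r, oo] of [0,oo] under the pairings. *)
Definition valuation_subbase (R : realType) (X : topologicalType) :
    set (set (valuation R X)) :=
  [set B | exists g (r : R),
    lsc_nneg g /\ B = [set nu : valuation R X | r%:E < vint nu g]].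

HB.instance Definition _ (R : realType) (X : topologicalType) :=
  isSubBaseTopological.Build (valuation R X) (@valuation_subbase R X) id.

Definition V (R : realType) (X : topologicalType) : topologicalType :=
  valuation R X.

(** The formulas determine the structure maps: a valuation [nu] is determined by
    its pairings, as [vint nu \1_U = nu U] for open [U]. *)
Record valuation_monad_data (R : realType) (M : monad (V R)) : Prop :=
  ValuationMonadData {
  valuation_fmap : forall (X Y : topologicalType) (f : continuousType X Y)
      (nu : V R X) (U : set Y),
    open U -> monad_fmap M f nu U = nu (f @^-1` U);
  valuation_unit : forall (X : topologicalType) (x : X) (U : set X),
    open U -> monad_unit M X x U = (\1_U x)%:E;
  valuation_mult : forall (X : topologicalType) (xi : V R (V R X))
      (g : X -> \bar R),
    lsc_nneg g ->
    vint (monad_mult M X xi) g = vint xi (fun rho : V R X => vint rho g) }.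

(** A [measurableType] is pointed while a space may be empty, so the Borel
    measurable type of [X] takes a point of [X] as a parameter. The
    sigma-algebra does not depend on it, and a space that carries a probability
    measure has one. *)

Definition borel_set (X : topologicalType) : set (set X) := <<s open >>.

Definition pointed_at (X : topologicalType) (x0 : X) : Type := X.

HB.instance Definition _ (X : topologicalType) (x0 : X) :=
  Choice.on (pointed_at x0).
HB.instance Definition _ (X : topologicalType) (x0 : X) :=
  isPointed.Build (pointed_at x0) x0.

Notation borelType x0 := (g_sigma_algebraType (open : set (set (pointed_at x0)))).

Definition borel_probability (R : realType) (X : topologicalType)
    (m : set X -> \bar R) : Prop :=
  exists (x0 : X) (p : probability (borelType x0) R),
    forall A, borel_set A -> m A = p A.

Section change_of_point.
Variables (R : realType) (X : topologicalType) (x0 y0 : X).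
Variable p : probability (borelType y0) R.

Let m : set (borelType x0) -> \bar R := p.

Let m0 : m set0 = 0. Proof. exact: (measure0 p). Qed.

Let m_ge0 A : 0 <= m A. Proof. exact: (measure_ge0 p). Qed.

Let m_semi_sigma_additive : semi_sigma_additive m.
Proof. by move=> F mF tF mUF; exact: (measure_semi_sigma_additive (s := p)). Qed.

HB.instance Definition _ := isMeasure.Build _ _ _ m
  m0 m_ge0 m_semi_sigma_additive.

Let m_setT : m [set: borelType x0] = 1.
Proof. exact: (probability_setT p). Qed.

HB.instance Definition _ := Measure_isProbability.Build _ _ _ m m_setT.

Lemma probability_change_point :
  exists q : probability (borelType x0) R, q = p :> (set X -> \bar R).
Proof. by exists m. Qed.

End change_of_point.

(** As for valuations, a map on the Borel sets is encoded as a map on all sets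
    that is 0 elsewhere. *)
Record tau_probability (R : realType) (X : topologicalType) := TauProbability {
  tau_fun :> set X -> \bar R;
  tau_nborel : forall A, ~ borel_set A -> tau_fun A = 0;
  tau_borel_probability : borel_probability tau_fun;
  tau_smooth : forall (I : Type) (le : I -> I -> Prop) (U : I -> set X),
    directed_open_net le U ->
    tau_fun (\bigcup_i U i) = ereal_sup (range (fun i => tau_fun (U i))) }.

Lemma tau_probabilityP (R : realType) (X : topologicalType)
    (p q : tau_probability R X) :
  (forall A, borel_set A -> p A = q A) -> p = q.
Proof.
move=> h; have fE : tau_fun p = tau_fun q.
  apply/funext => A; have [oA|nA] := pselect (borel_set A); first exact: h.
  by rewrite !tau_nborel.
case: p q fE {h} => [f a b c] [g a' b' c'] /= fg.
by subst g; congr TauProbability; exact: Prop_irrelevance.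
Qed.

Section restriction_to_open_sets.
Variables (R : realType) (X : topologicalType).

Lemma open_borel_set (U : set X) : open U -> borel_set U.
Proof. exact: sub_gen_smallest. Qed.

Definition restrict_open (m : set X -> \bar R) (U : set X) : \bar R :=
  if `[< open U >] then m U else 0.

Lemma restrict_openE (m : set X -> \bar R) (U : set X) :
  open U -> restrict_open m U = m U.
Proof. by rewrite /restrict_open => /asboolT ->. Qed.

Variable p : tau_probability R X.

Lemma restrict_open_nopen U : ~ open U -> restrict_open p U = 0.
Proof. by rewrite /restrict_open => /asboolF ->. Qed.

Lemma restrict_open_ge0 U : 0 <= restrict_open p U.
Proof.
rewrite /restrict_open; case: asboolP => // /open_borel_set bU.
by have [x0 [q qE]] := tau_borel_probability p; rewrite qE.
Qed.

Lemma restrict_open0 : restrict_open p set0 = 0.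
Proof.
rewrite (restrict_openE p open0).
have b0 : borel_set (@set0 X) by apply: open_borel_set; exact: open0.
by have [x0 [q qE]] := tau_borel_probability p; rewrite qE// measure0.
Qed.

Lemma restrict_open_modular U W : open U -> open W ->
  restrict_open p (U `|` W) + restrict_open p (U `&` W) =
  restrict_open p U + restrict_open p W.
Proof.
move=> oU oW; rewrite (restrict_openE p (openU oU oW)) (restrict_openE p (openI oU oW)).
rewrite !restrict_openE//.
have bU := open_borel_set oU; have bW := open_borel_set oW.
have bUW := open_borel_set (openU oU oW).
have bIUW := open_borel_set (openI oU oW).
have [x0 [q qE]] := tau_borel_probability p; rewrite !qE//.
have mU : measurable (U : set (borelType x0)) by [].
have mW : measurable (W : set (borelType x0)) by [].
have qU : q U < +oo by rewrite (le_lt_trans (probability_le1 q mU))// ltry.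
by rewrite measureUfinl// subeK// fin_num_measure//; exact: measurableI.
Qed.

Lemma restrict_open_directed (I : Type) (le : I -> I -> Prop)
    (U : I -> set X) : directed_open_net le U ->
  restrict_open p (\bigcup_i U i) =
  ereal_sup (range (fun i => restrict_open p (U i))).
Proof.
move=> dU; have [_ oU _] := dU.
have oUU : open (\bigcup_i U i) by apply: bigcup_open => i _; exact: oU.
rewrite restrict_openE// (tau_smooth p dU); congr (ereal_sup _).
by apply: eq_imagel => i _; rewrite restrict_openE.
Qed.

Definition inclusion_fun : valuation R X :=
  Valuation restrict_open_nopen restrict_open_ge0 restrict_open0
    restrict_open_modular restrict_open_directed.

End restriction_to_open_sets.

HB.instance Definition _ (R : realType) (X : topologicalType) :=
  gen_eqMixin (tau_probability R X).
HB.instance Definition _ (R : realType) (X : topologicalType) :=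
  gen_choiceMixin (tau_probability R X).
HB.instance Definition _ (R : realType) (X : topologicalType) :=
  Topological.copy (tau_probability R X)
    (initial_topology (@inclusion_fun R X : tau_probability R X -> V R X)).

Definition P (R : realType) (X : topologicalType) : topologicalType :=
  tau_probability R X.

Lemma inclusion_continuous (R : realType) (X : topologicalType) :
  continuous (@inclusion_fun R X : P R X -> V R X).
Proof. exact: initial_continuous. Qed.

Definition inclusion (R : realType) (X : topologicalType) :
    continuousType (P R X) (V R X) :=
  mkcts (@inclusion_continuous R X).

(** [P R X] can thus be regarded as a subset of [V R X]. *)
Lemma inclusion_injective (R : realType) (X : topologicalType) :
  injective (inclusion R X).
Proof.
move=> p q pq; have opq (U : set X) : open U -> p U = q U.
  move=> oU; have := congr1 (fun nu : valuation R X => nu U) pq.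
  by rewrite /= !restrict_openE.
apply: tau_probabilityP => A bA.
have [x0 [p' pE]] := tau_borel_probability p.
have [y0 [q' qE]] := tau_borel_probability q.
have [q'' q''E] := probability_change_point x0 q'.
rewrite pE// qE// -q''E.
apply: (@g_sigma_algebra_measure_unique _ R (borelType x0) open _
  (fun=> setT) _ _ p' q'') => //.
- exact: sub_gen_smallest.
- by move=> _; exact: openT.
- by rewrite bigcup_const//; exists 0%N.
- exact: openI.
- move=> B oB; have bB := open_borel_set oB.
  rewrite /= q''E; apply: etrans (esym (pE B bB)) _.
  exact: etrans (opq B oB) (qE B bB).
- by move=> _; rewrite (le_lt_trans (probability_le1 p' _)) ?ltry//.
Qed.

(** The integral does not depend on [p0], and such a point exists as [mu] is a
    probability measure. *)
Record probability_monad_data (R : realType) (M : monad (P R)) : Prop :=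
  ProbabilityMonadData {
  probability_fmap : forall (X Y : topologicalType) (f : continuousType X Y)
      (p : P R X) (B : set Y),
    borel_set B -> monad_fmap M f p B = p (f @^-1` B);
  probability_unit : forall (X : topologicalType) (x : X) (A : set X),
    borel_set A ->
    monad_unit M X x A = \d_(x : borelType x) A;
  probability_mult : forall (X : topologicalType) (mu : P R (P R X))
      (A : set X),
    borel_set A -> forall p0 : P R X,
    monad_mult M X mu A =
    \int[(mu : set (borelType p0) -> \bar R)]_p (p : P R X) A }.

(* Main.v *)
Require Import Defs.
From HB Require Import structures.
From mathcomp Require Import all_boot all_order all_algebra.
From mathcomp Require Import all_classical all_reals all_analysis.
From mathcomp Require Import measurable_realfun.
From mathcomp Require Import zify lra.

(** Why the theorem holds.

    Everything about the valuation monad follows from three properties of the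
    pairing [vint nu g]: it is additive in [g], it commutes with multiplication
    by positive reals, and it preserves directed suprema.  The second is clear
    from the definition; the other two rest on one formula, [vint_dyadic]:
    cutting the range of [g] at the points [k / 2 ^ n] gives

      [vint nu g = sup_n 2 ^- n * \sum_(1 <= k <= n 2 ^ n) nu [set x | k / 2 ^ n < g x]].

    The right-hand side visibly preserves directed suprema of [g], because [nu]
    does.  The content of the formula is that the integral of a simple function
    does not depend on how it is written as a combination of open sets, and is
    monotone.  For dyadic coefficients this is a statement about finite lists of
    open sets, compared by the number of members that a point belongs to
    ([sum_nat_le]).  A list [s] of open sets can be replaced by the decreasing
    list of its levels, the sets of the points that lie in at least [k] members,
    and [sum_levels] shows that [\sum_(U <- s) nu U] does not change.  The proof
    only adds instances of the modular law and cancels nothing, so the value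
    [+oo] is harmless.  General coefficients, possibly infinite, are suprema of
    dyadic ones.  Additivity then follows from the dyadic case, where it is
    concatenation of lists.

    A valuation is determined by its pairings ([valuation_ext]), and the pairings
    with the image, the Dirac and the flattened valuations are
    [vint nu (g \o f)], [g x] and [vint xi (fun rho => vint rho g)].  With these
    three formulas each law of the valuation monad becomes an identity between
    pairings, and continuity of each structure map says that a pairing depends
    lower semicontinuously on its argument.

    For probability measures the link is [integral_lsc]: the Lebesgue integral
    of a lower semicontinuous function is its pairing with the restricted
    valuation, since both are limits of the same dyadic sums.  Consequently the
    averaged measure [A |-> \int[mu]_p p A] inherits tau-smoothness from
    Scott-continuity of the pairing, and on open sets it agrees with the
    flattening of the image of [mu] in the valuations of valuations.  Thus the
    inclusion commutes with image, unit and multiplication; as it is injective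
    and induces the topology, continuity and all the monad laws for
    probabilities are pulled back from those for valuations. *)

Set Implicit Arguments.
Unset Strict Implicit.
Unset Printing Implicit Defensive.

Import Order.TTheory GRing.Theory Num.Theory.
Import numFieldNormedType.Exports.

Local Open Scope classical_set_scope.
Local Open Scope ring_scope.
Local Open Scope ereal_scope.

(** * Suprema in the extended half-line *)

Local Notation esup f := (ereal_sup (range f)).

Section suprema.
Variable R : realType.

Lemma esup_ge (I : Type) (f : I -> \bar R) i : f i <= esup f.
Proof. exact/ereal_sup_ubound/imageT. Qed.

Lemma esup_le (I : Type) (f : I -> \bar R) x :
  (forall i, f i <= x) -> esup f <= x.
Proof. by move=> h; apply: ge_ereal_sup => _ [i _ <-]. Qed.

Lemma eq_esup (I : Type) (f g : I -> \bar R) :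
  (forall i, f i = g i) -> esup f = esup g.
Proof. by move=> fg; have -> : f = g by apply/funext. Qed.

Lemma esup_gt (I : Type) (f : I -> \bar R) x :
  x < esup f -> exists i, x < f i.
Proof. by move=> /ereal_sup_gt[_ [i _ <-] ?]; exists i. Qed.

Lemma esup_swap (I J : Type) (f : I -> J -> \bar R) :
  esup (fun i => esup (f i)) = esup (fun j => esup (fun i => f i j)).
Proof.
apply/eqP; rewrite eq_le; apply/andP; split.
  apply: esup_le => i; apply: esup_le => j.
  by apply: (le_trans (esup_ge (f^~ j) i)); exact: (esup_ge (fun j => esup (f^~ j))).
apply: esup_le => j; apply: esup_le => i.
by apply: (le_trans (esup_ge (f i) j)); exact: (esup_ge (fun i => esup (f i))).
Qed.

Lemma esup_mull (I : Type) (c : \bar R) (f : I -> \bar R) : inhabited I ->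
  0 <= c -> (forall i, 0 <= f i) ->
  c * esup f = esup (fun i => c * f i).
Proof.
move=> [i0] c0 f0; case: c c0 => [c|_|//].
  rewrite lee_fin => c0; rewrite -ereal_supZl//; last first.
    by apply/set0P; exists (f i0), i0.
  by rewrite image_comp.
(* An infinite factor sends a null family to 0 and any other one to [+oo]. *)
have [[i fi]|nf] := pselect (exists i, 0 < f i).
  rewrite gt0_mulye; last by apply: (lt_le_trans fi); exact: esup_ge.
  apply/esym/eqP; rewrite -leye_eq -[leLHS](gt0_mulye fi).
  exact: (esup_ge (fun i => +oo * f i) i).
have {nf}f0 i : f i = 0.
  by apply/eqP; rewrite eq_le f0 leNgt andbT; apply/negP => fi; apply: nf; exists i.
have -> : f = fun=> 0 by apply/funext.
have e0 : esup (fun _ : I => 0 : \bar R) = 0.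
  by apply/eqP; rewrite eq_le (esup_ge (fun=> 0) i0) andbT; exact: esup_le.
by rewrite e0 mule0 -[LHS]e0; exact: eq_esup.
Qed.

(** For a directed index set one index serves both summands. *)
Lemma esup_add (I : Type) (le : I -> I -> Prop) (f g : I -> \bar R) :
  directed le -> (forall i, 0 <= f i) -> (forall i, 0 <= g i) ->
  (forall i j, le i j -> f i <= f j) -> (forall i j, le i j -> g i <= g j) ->
  esup (fun i => f i + g i) = esup f + esup g.
Proof.
move=> [[i0] _ _ dir] f0 g0 fle gle; apply/eqP; rewrite eq_le; apply/andP; split.
  by apply: esup_le => i; exact: leeD (esup_ge _ _) (esup_ge _ _).
have fS i : f i <= esup (fun i => f i + g i).
  by apply: (le_trans _ (esup_ge (fun i => f i + g i) i)); exact: leeDl.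
have gS i : g i <= esup (fun i => f i + g i).
  by apply: (le_trans _ (esup_ge (fun i => f i + g i) i)); exact: leeDr.
have sf0 : 0 <= esup f by apply: (le_trans (f0 i0)); exact: esup_ge.
have sg0 : 0 <= esup g by apply: (le_trans (g0 i0)); exact: esup_ge.
have [fy|fy] := eqVneq (esup f) +oo.
  apply: le_trans (leey _) _; rewrite -fy; exact: esup_le.
have [gy|gy] := eqVneq (esup g) +oo.
  apply: le_trans (leey _) _; rewrite -gy; exact: esup_le.
have ff : esup f \is a fin_num by rewrite ge0_fin_numE// ltey.
have gf : esup g \is a fin_num by rewrite ge0_fin_numE// ltey.
apply/lee_addgt0Pr => e e0; have e20 : (0 < e / 2)%R by rewrite divr_gt0.
have [_ [i _ <-] hi] := ub_ereal_sup_adherent e20 ff.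
have [_ [j _ <-] hj] := ub_ereal_sup_adherent e20 gf.
have [k ik jk] := dir i j.
have hf : esup f <= f k + (e / 2)%:E.
  by rewrite -leeBlDr//; apply: le_trans (ltW hi) (fle _ _ ik).
have hg : esup g <= g k + (e / 2)%:E.
  by rewrite -leeBlDr//; apply: le_trans (ltW hj) (gle _ _ jk).
apply: le_trans (leeD hf hg) _.
rewrite addeACA -EFinD -splitr leeD2r//; exact: (esup_ge (fun k => f k + g k)).
Qed.

Lemma esup_sum (I : Type) (le : I -> I -> Prop) (J : Type) (s : seq J)
    (f : J -> I -> \bar R) :
  directed le -> (forall j i, 0 <= f j i) ->
  (forall j i i', le i i' -> f j i <= f j i') ->
  esup (fun i => \sum_(j <- s) f j i) = \sum_(j <- s) esup (f j).
Proof.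
move=> dir f0 fle; elim: s => [|j s IH].
  rewrite big_nil; have [[i0] _ _ _] := dir.
  apply/eqP; rewrite eq_le; apply/andP; split.
    by apply: esup_le => i; rewrite big_nil.
  by apply: (le_trans _ (esup_ge (fun=> _) i0)); rewrite big_nil.
rewrite big_cons -IH -(esup_add dir)//.
- by apply: eq_esup => i; rewrite big_cons.
- by move=> i; apply: sume_ge0.
- by apply: fle.
- by move=> i i' ii'; apply: lee_sum => k _; exact: fle.
Qed.

Lemma directed_leq : directed (fun m n : nat => (m <= n)%N).
Proof.
split; [by exists; exact: 0%N|exact: leqnn|by move=> i j k; exact: leq_trans|].
by move=> i j; exists (maxn i j); rewrite ?leq_maxl ?leq_maxr.
Qed.

End suprema.

(** * Finite lists of open sets *)

Definition multiplicity (X : Type) (s : seq (set X)) (x : X) : nat :=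
  count (fun U : set X => x \in U) s.

Definition open_list (X : topologicalType) (s : seq (set X)) : Prop :=
  {in s, forall U : set X, open U}.

Section valuation_facts.
Variables (R : realType) (X : topologicalType) (nu : valuation R X).

(** Monotonicity is Scott-continuity along the two-element chain [U, W]. *)
Lemma valuation_le (U W : set X) : open U -> open W -> U `<=` W ->
  nu U <= nu W.
Proof.
move=> oU oW UW; pose F (b : bool) := if b then W else U.
have dF : directed_open_net (fun b c : bool => b ==> c) F.
  split.
  - split; [by exists; exact: true|by case|by move=> [] [] []|].
    by move=> b c; exists true; rewrite implybT.
  - by case.
  - by case=> [] [] // _.
have := valuation_directed nu dF.
have -> : \bigcup_b F b = W.
  apply/seteqP; split=> [x [[] _ /=]|x Wx]; [by []|exact: UW|by exists true].
by move=> ->; exact: (esup_ge (fun b => nu (F b)) false).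
Qed.

Definition level (s : seq (set X)) (k : nat) : set X :=
  [set x | (k <= multiplicity s x)%N].

Lemma level0 s : level s 0 = setT.
Proof. by apply/seteqP; split. Qed.

Lemma level_nil k : level [::] k.+1 = set0.
Proof. by apply/seteqP; split. Qed.

Lemma levelS s k : level s k.+1 `<=` level s k.
Proof. by move=> x; rewrite /level/=; exact: ltnW. Qed.

Lemma level_cons W s k :
  level (W :: s) k.+1 = level s k.+1 `|` (W `&` level s k).
Proof.
apply/seteqP; split=> x; rewrite /level /multiplicity/=.
  by case: (boolP (x \in W)) => [/set_mem Wx|_]; rewrite ?add1n ?add0n; auto.
case=> [h|[Wx h]]; first by rewrite (leq_trans h)// leq_addl.
by rewrite mem_set// add1n.
Qed.

Lemma level_big s k : (size s < k)%N -> level s k = set0.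
Proof.
move=> sk; apply/seteqP; split=> // x; rewrite /level/= => h.
by have := leq_ltn_trans (leq_trans h (count_size _ _)) sk; rewrite ltnn.
Qed.

Lemma open_listP (W : set X) s : open_list (W :: s) -> open W /\ open_list s.
Proof.
move=> o; split; first by apply: o; rewrite inE eqxx.
by move=> U Us; apply: o; rewrite inE Us orbT.
Qed.

Lemma open_level (s : seq (set X)) k : open_list s -> open (level s k).
Proof.
elim: s k => [|W s IH] [|k] os; rewrite ?level0 ?level_nil//;
  [exact: openT|exact: open0|exact: openT|].
have [oW {}os] := open_listP os.
by rewrite level_cons; apply: openU; [|apply: openI => //]; exact: IH.
Qed.

(** Inserting [W] in front of a list, the modular law carries the part of [W]
    inside one level over to the next level: after [m] steps the first [m] levels
    are updated and [W `&` level s m] remains to be inserted.  Nothing is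
    cancelled, so infinite values are allowed. *)
Lemma level_insert (W : set X) s m : open W -> open_list s ->
  \sum_(k < m) nu (level s k.+1) + nu W =
  \sum_(k < m) nu (level (W :: s) k.+1) + nu (W `&` level s m).
Proof.
move=> oW os; elim: m => [|m IH]; first by rewrite !big_ord0 level0 setIT.
rewrite !big_ord_recr/= -addeAC IH -addeA -[RHS]addeA; congr (_ + _).
have oL := open_level m os; have oL1 := open_level m.+1 os.
rewrite level_cons addeC -(valuation_modular nu oL1 (openI oW oL)).
congr (_ + nu _); rewrite setICA; congr (_ `&` _).
by apply/setIidl; exact: levelS.
Qed.

(** The layer-cake identity: a list and the decreasing list of its levels have
    the same sum. *)
Lemma sum_levels (s : seq (set X)) N : open_list s -> (size s <= N)%N ->
  \sum_(U <- s) nu U = \sum_(k < N) nu (level s k.+1).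
Proof.
elim: s N => [|W s IH] N os sN.
  by rewrite big_nil big1// => k _; rewrite level_nil valuation0.
case: N sN => // N sN; have [oW {}os] := open_listP os.
rewrite big_cons (IH N)// addeC level_insert// big_ord_recr/=; congr (_ + nu _).
by rewrite level_cons (@level_big s N.+1)// set0U.
Qed.

(** Pointwise comparison of multiplicities is inclusion of levels, so it passes
    to sums; the integer weights allow lists at different dyadic scales to be
    compared. *)
Lemma sum_nat_le a b (s t : seq (set X)) : open_list s -> open_list t ->
  (forall x, a * multiplicity s x <= b * multiplicity t x)%N ->
  a%:R%:E * \sum_(U <- s) nu U <= b%:R%:E * \sum_(U <- t) nu U.
Proof.
(* A weight is absorbed by repeating the list. *)
pose rep c (r : seq (set X)) := flatten (nseq c r).
have orep c r : open_list r -> open_list (rep c r).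
  by move=> or U /flattenP[r' /nseqP[-> _]]; exact: or.
have mrep c r x : multiplicity (rep c r) x = (c * multiplicity r x)%N.
  by rewrite /multiplicity count_flatten map_nseq sumn_nseq mulnC.
have srep c r : \sum_(U <- rep c r) nu U = c%:R%:E * \sum_(U <- r) nu U.
  rewrite big_flatten/= big_nseq; elim: c => [|c IH]; first by rewrite mul0e.
  rewrite iterS IH -natr1 EFinD ge0_muleDl ?lee_fin//.
  by rewrite mul1e addeC.
move=> os ot st; rewrite -!srep; set N := maxn (size (rep a s)) (size (rep b t)).
rewrite (@sum_levels _ N) ?leq_maxl//; last exact: orep.
rewrite (@sum_levels _ N) ?leq_maxr//; last exact: orep.
apply: lee_sum => k _; apply: valuation_le; [exact/open_level/orep..|].
by move=> x; rewrite /level/= !mrep => h; exact: leq_trans (st x).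
Qed.

End valuation_facts.

(** * Dyadic approximation *)

Section dyadic.
Variable R : realType.
Implicit Types (x y : \bar R) (n k : nat).

(** The number of points [k / 2 ^ n], with [1 <= k <= n 2 ^ n], strictly below
    [y].  Divided by [2 ^ n] it is the dyadic approximation of [y] from below; the
    cut-off makes it finite for [y = +oo], and the strict inequality turns the
    sets counted for a lower semicontinuous function into open sets. *)
Definition dyadic_count n y : nat :=
  count (fun k => (k.+1%:R / 2 ^+ n)%:E < y) (iota 0 (n * 2 ^ n)).

(** A downward closed predicate is counted by an initial segment. *)
Lemma lt_count_iota (Q : pred nat) M k :
  (forall i j, (i <= j)%N -> Q j -> Q i) ->
  (k < count Q (iota 0 M))%N = (k < M)%N && Q k.
Proof.
move=> dQ; elim: M k => [|M IH] k; first by rewrite ltn0.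
rewrite -[X in iota 0 X]addn1 iotaD count_cat/= add0n addn0.
have cM : (count Q (iota 0 M) <= M)%N.
  by rewrite (leq_trans (count_size _ _))// size_iota.
have [QM|nQM] := boolP (Q M); rewrite ?addn0 ?addn1/=.
  have cE : count Q (iota 0 M) = M.
    apply/eqP; rewrite eqn_leq cM/=; case: M QM IH {cM} => // M QM IH; rewrite IH.
    by rewrite ltnSn/= (dQ _ _ _ QM).
  by rewrite cE; apply/esym/andb_idr; rewrite ltnS => /dQ; apply.
rewrite IH ltnS [in RHS]leq_eqVlt andb_orl.
by case: eqVneq => // ->; rewrite (negbTE nQM) andbF.
Qed.

Lemma lt_dyadic_count n y k :
  (k < dyadic_count n y)%N = (k < n * 2 ^ n)%N && ((k.+1%:R / 2 ^+ n)%:E < y).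
Proof.
rewrite lt_count_iota// => i j ij; apply: le_lt_trans.
by rewrite lee_fin ler_pM2r ?ler_nat// invr_gt0 exprn_gt0.
Qed.

Lemma dyadic_count_lt n y : 0 < y ->
  ((dyadic_count n y)%:R / 2 ^+ n)%:E < y.
Proof.
move=> y0; case E : (dyadic_count n y) => [|c]; first by rewrite mul0r.
by have := lt_dyadic_count n y c; rewrite E ltnSn => /esym/andP[].
Qed.

Lemma dyadic_count_le n y : 0 <= y ->
  ((dyadic_count n y)%:R / 2 ^+ n)%:E <= y.
Proof.
move=> y0; case E : (dyadic_count n y) => [|c]; first by rewrite mul0r.
by have := lt_dyadic_count n y c; rewrite E ltnSn => /esym/andP[_ /ltW].
Qed.

(** Refining the grid replaces each point below [y] by two. *)
Lemma dyadic_countS n y :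
  (2 * dyadic_count n y <= dyadic_count n.+1 y)%N.
Proof.
case E : (dyadic_count n y) => [|c]; first by rewrite muln0.
have := lt_dyadic_count n y c; rewrite E ltnSn => /esym/andP[cn cy].
have -> : (2 * c.+1 = (2 * c).+1.+1)%N by lia.
rewrite lt_dyadic_count; apply/andP; split.
  by rewrite expnS; nia.
have -> : ((2 * c).+1.+1%:R / 2 ^+ n.+1 = c.+1%:R / 2 ^+ n :> R)%R.
  rewrite (_ : (2 * c).+1.+1 = (2 * c.+1)%N); last by lia.
  by rewrite natrM exprS -mulf_div divff ?mul1r// pnatr_eq0.
by [].
Qed.

Lemma dyadic_value_homo y :
  {homo (fun n => ((dyadic_count n y)%:R / 2 ^+ n)%:E : \bar R) :
    m n / (m <= n)%N >-> m <= n}.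
Proof.
apply: homo_leq => [//|a b c|n]; first exact: le_trans.
have -> : ((dyadic_count n y)%:R / 2 ^+ n =
    (2 * dyadic_count n y)%:R / 2 ^+ n.+1 :> R)%R.
  by rewrite natrM exprS -mulf_div divff ?mul1r// pnatr_eq0.
by rewrite lee_fin ler_pM2r ?invr_gt0 ?exprn_gt0// ler_nat dyadic_countS.
Qed.

Lemma dyadic_count_gt y (r : R) : 0 <= y -> r%:E < y ->
  exists n, (r < (dyadic_count n y)%:R / 2 ^+ n)%R.
Proof.
move=> y0 ry; have [r0|r0] := ltP r 0%R.
  by exists 0%N; apply: lt_le_trans r0 _; rewrite divr_ge0.
have [e e0 ey] : exists2 e : R, (0 < e)%R & (r + e)%:E < y.
  case: y ry {y0} => [y||//] ry; last by exists 1%R => //; exact: ltry.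
  by exists ((y - r) / 2)%R; rewrite !lte_fin in ry *; lra.
have [N hN] : exists N : nat, (e^-1 < N%:R)%R.
  by exists (Num.bound e^-1); rewrite archi_boundP// invr_ge0 ltW.
(* The mesh [2 ^- n] must be below the gap [e], and the cut-off [n] above [r]. *)
pose n := maxn N (Num.truncn r).+1.
have nr : (r < n%:R)%R.
  apply: lt_le_trans (truncnS_gt r) _; by rewrite ler_nat leq_maxr.
have n2 : (n%:R < 2 ^+ n :> R)%R by rewrite -natrX ltr_nat ltn_expl.
have p2 : (0 < 2 ^+ n :> R)%R by rewrite exprn_gt0.
have ne : (2 ^- n < e)%R.
  rewrite -[e]invrK ltf_pV2 ?posrE ?invr_gt0//.
  apply: lt_trans hN (le_lt_trans _ n2); by rewrite ler_nat leq_maxl.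
pose k := Num.truncn (r * 2 ^+ n).
have rn0 : (0 <= r * 2 ^+ n)%R by rewrite mulr_ge0// ltW.
have kr : (k%:R <= r * 2 ^+ n)%R by rewrite truncn_le.
have rk : (r * 2 ^+ n < k.+1%:R)%R by exact: truncnS_gt.
exists n; rewrite ltr_pdivlMr//; apply: lt_le_trans rk _.
rewrite ler_nat lt_dyadic_count; apply/andP; split.
  rewrite -(ltr_nat R) natrM natrX; apply: le_lt_trans kr _.
  by rewrite ltr_pM2r.
apply: le_lt_trans ey; rewrite lee_fin -natr1 mulrDl div1r.
by apply: lerD (ltW ne); rewrite ler_pdivrMr.
Qed.

Lemma esup_dyadic y : 0 <= y ->
  esup (fun n => ((dyadic_count n y)%:R / 2 ^+ n)%:E) = y.
Proof.
move=> y0; apply/eqP; rewrite eq_le; apply/andP; split.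
  by apply: esup_le => n; exact: dyadic_count_le.
set S := ereal_sup _; rewrite leNgt; apply/negP => Sy.
have S0 : 0 <= S by apply: (le_trans _ (esup_ge (fun n => _) 0%N)); rewrite lee_fin divr_ge0.
have Sf : S \is a fin_num by rewrite ge0_fin_numE// (lt_le_trans Sy)// leey.
have [|n] := @dyadic_count_gt y (fine S) y0; first by rewrite fineK.
rewrite -lte_fin fineK// ltNge => /negP; apply.
exact: (esup_ge (fun n => ((dyadic_count n y)%:R / 2 ^+ n)%:E) n).
Qed.

End dyadic.

Section dyadic_simple.
Variables (R : realType) (X : topologicalType).
Implicit Types (g : X -> \bar R) (s t : seq (set X)).

Definition dyadic_levels g n : seq (set X) :=
  [seq [set x | (k.+1%:R / 2 ^+ n)%:E < g x] | k <- iota 0 (n * 2 ^ n)].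

Definition dyadic_simple n s (x : X) : \bar R :=
  ((multiplicity s x)%:R / 2 ^+ n)%:E.

Lemma multiplicity_dyadic_levels g n x :
  multiplicity (dyadic_levels g n) x = dyadic_count n (g x).
Proof.
rewrite /multiplicity /dyadic_levels count_map; apply: eq_count => k /=.
by apply/idP/idP => [/set_mem//|h]; exact/mem_set.
Qed.

Lemma dyadic_simple_ge0 n s x : 0 <= dyadic_simple n s x.
Proof. by rewrite lee_fin divr_ge0. Qed.

Lemma dyadic_simple_levels_le g n x : 0 <= g x ->
  dyadic_simple n (dyadic_levels g n) x <= g x.
Proof. by rewrite /dyadic_simple multiplicity_dyadic_levels; exact: dyadic_count_le. Qed.

Lemma dyadic_simple_levels_homo g x : {homo (fun n =>
  dyadic_simple n (dyadic_levels g n) x) : m n / (m <= n)%N >-> m <= n}.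
Proof.
move=> m n mn; rewrite /dyadic_simple !multiplicity_dyadic_levels.
exact: dyadic_value_homo.
Qed.

Lemma esup_dyadic_simple g x : 0 <= g x ->
  esup (fun n => dyadic_simple n (dyadic_levels g n) x) = g x.
Proof.
move=> gx; rewrite -[RHS]esup_dyadic//; apply: eq_esup => n.
by rewrite /dyadic_simple multiplicity_dyadic_levels.
Qed.

Lemma dyadic_simple_sum n s x : dyadic_simple n s x =
  \sum_(U <- s) (2 ^- n)%:E * (\1_U x)%:E.
Proof.
rewrite /dyadic_simple /multiplicity; elim: s => [|U s IH].
  by rewrite big_nil mul0r.
rewrite big_cons -IH /= -EFinM -EFinD indicE natrD; congr (_%:E).
by rewrite mulrDl mulrC.
Qed.

Lemma dyadic_simple_cat n s t x :
  dyadic_simple n (s ++ t) x = dyadic_simple n s x + dyadic_simple n t x.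
Proof. by rewrite !dyadic_simple_sum big_cat. Qed.

Lemma open_dyadic_levels g n : lsc_nneg g -> open_list (dyadic_levels g n).
Proof.
by move=> [_ /lower_semicontinuousP og] _ /mapP[k _ ->]; exact: og.
Qed.

Lemma dyadic_simple_lsc n s : open_list s -> lsc_nneg (dyadic_simple n s).
Proof.
move=> os; split; first by move=> x; exact: dyadic_simple_ge0.
apply/lower_semicontinuousP => r.
rewrite (_ : [set _ | _] =
    \bigcup_(k in [set k : nat | (r < k%:R / 2 ^+ n)%R]) level s k).
  by apply: bigcup_open => k _; exact: open_level.
apply/seteqP; split => [x /= rx|x [k /= rk]].
  by exists (multiplicity s x); rewrite /level//= -lte_fin.
rewrite /level/= => ks; rewrite lte_fin; apply: lt_le_trans rk _.
by rewrite ler_pM2r ?ler_nat// invr_gt0 exprn_gt0.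
Qed.

(** The multiplicities of [s] are bounded by its size, so one cut-off serves all
    points; a grid value within the cut-off that is strictly below [g x] is at
    most the dyadic approximation of [g x]. *)
Lemma dyadic_simple_le_levels n s g :
  (forall x, (0 < multiplicity s x)%N -> dyadic_simple n s x < g x) ->
  exists m, forall x,
    dyadic_simple n s x <= dyadic_simple m (dyadic_levels g m) x.
Proof.
move=> sg; pose m := maxn n (size s); exists m => x.
have [c0|cp] := posnP (multiplicity s x).
  by rewrite /dyadic_simple c0 mul0r lee_fin divr_ge0.
have := sg x cp; rewrite /dyadic_simple multiplicity_dyadic_levels.
have nm : (n <= m)%N by rewrite leq_maxl.
have -> : ((multiplicity s x)%:R / 2 ^+ n =
    (multiplicity s x * 2 ^ (m - n))%:R / 2 ^+ m :> R)%R.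
  by rewrite natrM natrX -{2}(subnK nm) exprD invfM mulrA mulfK.
have c2 : (0 < multiplicity s x * 2 ^ (m - n))%N by rewrite muln_gt0 cp expn_gt0.
rewrite -(prednK c2) => h.
rewrite lee_fin ler_pM2r ?invr_gt0 ?exprn_gt0// ler_nat lt_dyadic_count h andbT.
rewrite prednK// leq_mul//; last by rewrite leq_exp2l// leq_subr.
by rewrite (leq_trans (count_size _ _))// leq_maxr.
Qed.

Variable nu : valuation R X.

Definition dyadic_sum n s : \bar R := (2 ^- n)%:E * \sum_(U <- s) nu U.

Lemma sum_valuation_ge0 s : 0 <= \sum_(U <- s) nu U.
Proof. by apply: sume_ge0 => U _; exact: valuation_ge0. Qed.

Lemma dyadic_sum_cat n s t : dyadic_sum n (s ++ t) = dyadic_sum n s + dyadic_sum n t.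
Proof. by rewrite /dyadic_sum big_cat/= ge0_muleDr// sum_valuation_ge0. Qed.

(** Monotonicity of the integral on dyadic simple functions; in particular the
    integral depends on the function and not on the list that represents it. *)
Lemma dyadic_sum_le n s m t : open_list s -> open_list t ->
  (forall x, dyadic_simple n s x <= dyadic_simple m t x) ->
  dyadic_sum n s <= dyadic_sum m t.
Proof.
move=> os ot st.
have /(sum_nat_le nu os ot) h :
    forall x, (2 ^ m * multiplicity s x <= 2 ^ n * multiplicity t x)%N.
  move=> x; have := st x; rewrite lee_fin ler_pdivrMr ?exprn_gt0//.
  rewrite mulrAC ler_pdivlMr ?exprn_gt0// -!natrX -!natrM ler_nat.
  by rewrite mulnC [leqRHS]mulnC.
have sE k l r : dyadic_sum k r = (2 ^- k * 2 ^- l)%:E *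
    ((2 ^ l)%N%:R%:E * \sum_(U <- r) nu U).
  by rewrite muleA -EFinM natrX mulfVK// expf_neq0// pnatr_eq0.
by rewrite (sE n m) (sE m n) mulrC lee_pmul2l.
Qed.

Lemma dyadic_sum_le_vint n s g : open_list s ->
  (forall x, dyadic_simple n s x <= g x) -> dyadic_sum n s <= vint nu g.
Proof.
move=> os sg; apply: ereal_sup_ubound.
exists (size s), (fun=> (2 ^- n)%:E), (fun i => tnth (in_tuple s) i); split.
- by move=> i; rewrite lte_fin invr_gt0 exprn_gt0.
- by move=> i; apply: os; exact: mem_tnth.
- by move=> x; apply: le_trans (sg x); rewrite dyadic_simple_sum [leRHS]big_tnth.
- by rewrite /dyadic_sum big_tnth ge0_sume_distrr// => i _; exact: valuation_ge0.
Qed.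

(** The coefficients of a simple function below [g] are approximated from below
    by dyadic numbers.  This makes the simple function strictly smaller wherever
    it is positive, so it lies below some dyadic approximation of [g], and the
    two sums can be compared. *)
Lemma vint_le_dyadic_sums g : lsc_nneg g ->
  vint nu g <= esup (fun n => dyadic_sum n (dyadic_levels g n)).
Proof.
move=> lg; apply: ge_ereal_sup => _ [N [r [U [r0 oU rg ->]]]].
pose a n i := dyadic_count n (r i).
have aS i : r i * nu (U i) = esup (fun n => ((a n i)%:R / 2 ^+ n)%:E * nu (U i)).
  rewrite -[in LHS](esup_dyadic (ltW (r0 i))) muleC esup_mull; last first.
  - by move=> n; rewrite lee_fin divr_ge0.
  - exact: valuation_ge0.
  - by exists; exact: 0%N.
  by apply: eq_esup => n; rewrite muleC.
under eq_bigr do rewrite aS.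
rewrite -(esup_sum _ directed_leq); first last.
- move=> i n m nm; apply: lee_wpmul2r; first exact: valuation_ge0.
  exact: dyadic_value_homo.
- by move=> i n; rewrite mule_ge0 ?valuation_ge0// lee_fin divr_ge0.
apply: esup_le => n.
(* The approximated simple function as a list of open sets, with repetitions. *)
pose s := flatten [seq nseq (a n i) (U i) | i <- index_enum 'I_N].
have os : open_list s.
  by move=> W /flattenP[_ /mapP[i _ ->]] /nseqP[-> _]; exact: oU.
have -> : \sum_(i < N) ((a n i)%:R / 2 ^+ n)%:E * nu (U i) = dyadic_sum n s.
  rewrite /dyadic_sum big_flatten big_map ge0_sume_distrr; last first.
    by move=> i _; exact: sum_valuation_ge0.
  apply: eq_bigr => i _; rewrite big_nseq mulrC EFinM -muleA; congr (_ * _).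
  elim: (a n i) => [|c IH]; first by rewrite mul0e.
  by rewrite iterS -IH -natr1 EFinD ge0_muleDl ?lee_fin// mul1e addeC.
have sE x : dyadic_simple n s x =
    \sum_(i < N) ((a n i)%:R / 2 ^+ n)%:E * (\1_(U i) x)%:E.
  rewrite dyadic_simple_sum big_flatten big_map; apply: eq_bigr => i _.
  rewrite big_nseq -!EFinM; elim: (a n i) => [|c IH].
    by rewrite !mul0r.
  by rewrite iterS IH/= -EFinD -[c.+1%:R]natr1 !mulrDl mul1r addrC.
have [x sx|m hm] := @dyadic_simple_le_levels n s g.
  apply: lt_le_trans (rg x); rewrite sE.
  have /hasP[_ /flattenP[_ /mapP[i _ ->]] /nseqP[-> ai] /set_mem Ux] :
    has (fun U : set X => x \in U) s by rewrite has_count.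
  rewrite (bigD1 i)//= [ltRHS](bigD1 i)//= lte_leD//.
  + by under eq_bigr do rewrite -EFinM; rewrite sumEFin.
  + by rewrite indicE mem_set// !mule1; exact: dyadic_count_lt.
  + apply: lee_sum => j _; apply: lee_wpmul2r; first by rewrite lee_fin.
    exact: (dyadic_count_le _ (ltW (r0 j))).
apply: le_trans (esup_ge (fun n => dyadic_sum n (dyadic_levels g n)) m).
by apply: dyadic_sum_le => //; exact: open_dyadic_levels.
Qed.

(** The supremum over all simple functions below [g] is reached along one explicit
    sequence that depends on [g] through its open level sets only. *)
Lemma vint_dyadic g : lsc_nneg g ->
  vint nu g = esup (fun n => dyadic_sum n (dyadic_levels g n)).
Proof.
move=> lg; have [g0 _] := lg; apply/eqP; rewrite eq_le vint_le_dyadic_sums//=.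
apply: esup_le => n; apply: dyadic_sum_le_vint; first exact: open_dyadic_levels.
by move=> x; exact: dyadic_simple_levels_le.
Qed.

Lemma vint_dyadic_simple n s : open_list s ->
  vint nu (dyadic_simple n s) = dyadic_sum n s.
Proof.
move=> os; have ls := dyadic_simple_lsc n os; apply/eqP; rewrite eq_le.
rewrite dyadic_sum_le_vint// andbT vint_dyadic//; apply: esup_le => m.
apply: dyadic_sum_le => // [|x]; first exact: open_dyadic_levels.
by apply: dyadic_simple_levels_le; exact: dyadic_simple_ge0.
Qed.

End dyadic_simple.

(** * Lower semicontinuous functions and their pairings *)

Section lsc_nneg_closure.
Variables (R : realType) (X : topologicalType).
Implicit Types f g : X -> \bar R.

Lemma set_gt_esup (I : Type) (f : I -> X -> \bar R) (a : R) :
  [set x | a%:E < esup (f^~ x)] = \bigcup_i [set x | a%:E < f i x].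
Proof.
apply/seteqP; split => [x /= /esup_gt[i ai]|x [i _ /= ai]]; first by exists i.
exact: lt_le_trans ai (esup_ge (f^~ x) i).
Qed.

Lemma lsc_nneg_esup (I : Type) (f : I -> X -> \bar R) : inhabited I ->
  (forall i, lsc_nneg (f i)) -> lsc_nneg (fun x => esup (f^~ x)).
Proof.
move=> [i0] lf; split=> [x|].
  by apply: le_trans (esup_ge (f^~ x) i0); have [] := lf i0.
apply/lower_semicontinuousP => a; rewrite set_gt_esup.
by apply: bigcup_open => i _; have [_ /lower_semicontinuousP] := lf i; apply.
Qed.

Lemma lsc_nneg_indic (U : set X) : open U ->
  lsc_nneg (fun x => (\1_U x)%:E : \bar R).
Proof.
move=> oU; split=> [x|]; first by rewrite lee_fin.
apply/lower_semicontinuousP => a.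
have [a0|a0] := ltP a 0%R.
  rewrite (_ : [set _ | _] = setT); first exact: openT.
  by apply/seteqP; split => // x _ /=; rewrite lte_fin (lt_le_trans a0).
have [a1|a1] := ltP a 1%R.
  rewrite (_ : [set _ | _] = U)//; apply/seteqP; split => x /=.
    rewrite lte_fin indicE; case: (boolP (x \in U)) => [/set_mem//|_].
    by rewrite ltNge a0.
  by move=> Ux; rewrite lte_fin indicE mem_set.
rewrite (_ : [set _ | _] = set0); first exact: open0.
apply/seteqP; split => // x /=; rewrite lte_fin ltNge => /negP; apply.
by apply: le_trans a1; rewrite indicE lern1 leq_b1.
Qed.

Lemma lsc_nneg0 : lsc_nneg (fun _ : X => 0 : \bar R).
Proof.
have -> : (fun=> 0) = (fun x => (\1_set0 x)%:E) :> (X -> \bar R).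
  by apply/funext => x; rewrite indic0.
by apply: lsc_nneg_indic; exact: open0.
Qed.

(** The approximations of [f] and [g] are added by concatenating their lists. *)
Lemma adde_dyadic f g : (forall x, 0 <= f x) -> (forall x, 0 <= g x) ->
  (fun x => f x + g x) = (fun x => esup (fun n =>
    dyadic_simple R n (dyadic_levels f n ++ dyadic_levels g n) x)).
Proof.
move=> f0 g0; apply/funext => x.
rewrite -[f x]esup_dyadic_simple// -[g x]esup_dyadic_simple//.
rewrite -(esup_add directed_leq).
- by apply: eq_esup => n; rewrite dyadic_simple_cat.
- by move=> n; exact: dyadic_simple_ge0.
- by move=> n; exact: dyadic_simple_ge0.
- by move=> m n; exact: dyadic_simple_levels_homo.
- by move=> m n; exact: dyadic_simple_levels_homo.
Qed.

Lemma open_dyadic_levels_cat f g n : lsc_nneg f -> lsc_nneg g ->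
  open_list (dyadic_levels f n ++ dyadic_levels g n).
Proof.
by move=> lf lg U; rewrite mem_cat => /orP[]; exact: open_dyadic_levels.
Qed.

Lemma lsc_nneg_add f g : lsc_nneg f -> lsc_nneg g ->
  lsc_nneg (fun x => f x + g x).
Proof.
move=> lf lg; have [f0 _] := lf; have [g0 _] := lg; rewrite adde_dyadic//.
apply: lsc_nneg_esup => [|n]; first by exists; exact: 0%N.
exact/dyadic_simple_lsc/open_dyadic_levels_cat.
Qed.

Lemma lsc_nneg_sum (J : Type) (s : seq J) (f : J -> X -> \bar R) :
  (forall j, lsc_nneg (f j)) -> lsc_nneg (fun x => \sum_(j <- s) f j x).
Proof.
move=> lf; elim: s => [|j s IH].
  have -> : (fun x => \sum_(j <- [::]) f j x) = (fun=> 0).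
    by apply/funext => x; rewrite big_nil.
  exact: lsc_nneg0.
have -> : (fun x => \sum_(j <- j :: s) f j x) =
    (fun x => f j x + \sum_(j <- s) f j x).
  by apply/funext => x; rewrite big_cons.
exact: lsc_nneg_add.
Qed.

Lemma lsc_nneg_scale (c : R) f : (0 < c)%R -> lsc_nneg f ->
  lsc_nneg (fun x => c%:E * f x).
Proof.
move=> c0 [f0 /lower_semicontinuousP lf]; split=> [x|].
  by rewrite mule_ge0// lee_fin ltW.
apply/lower_semicontinuousP => a.
rewrite (_ : [set _ | _] = [set x | (c^-1 * a)%:E < f x]); first exact: lf.
by apply/seteqP; split => x /=; rewrite EFinM lte_pdivrMl.
Qed.

End lsc_nneg_closure.

Section vint_theory.
Variables (R : realType) (X : topologicalType) (nu : valuation R X).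
Implicit Types f g : X -> \bar R.

Lemma vint_ge0 g : (forall x, 0 <= g x) -> 0 <= vint nu g.
Proof.
move=> g0; apply: ereal_sup_ubound; exists 0%N, (fun=> 0), (fun=> set0).
by split=> [[]//|[]//|x|]; rewrite big_ord0.
Qed.

Lemma vint_le f g : (forall x, f x <= g x) -> vint nu f <= vint nu g.
Proof.
move=> fg; apply: ereal_sup_le => _ [n [r [U [r0 oU rf ->]]]].
by exists n, r, U; split => // x; exact: le_trans (rf x) (fg x).
Qed.

(** Scott-continuity of [nu] on each set [[set x | a%:E < f i x]], followed by an
    exchange of suprema in the dyadic formula. *)
Lemma vint_esup (I : Type) (le : I -> I -> Prop) (f : I -> X -> \bar R) :
  directed le -> (forall i, lsc_nneg (f i)) ->
  (forall i j x, le i j -> f i x <= f j x) ->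
  vint nu (fun x => esup (f^~ x)) = esup (fun i => vint nu (f i)).
Proof.
move=> dle lf fle; have [I0 _ _ _] := dle.
rewrite vint_dyadic; last exact: lsc_nneg_esup.
under [RHS]eq_esup do rewrite vint_dyadic//.
rewrite [RHS]esup_swap; apply: eq_esup => n.
have dnet a : directed_open_net le (fun i => [set x | a%:E < f i x]).
  split => // [i|i j ij x /=].
    by have [_ /lower_semicontinuousP] := lf i; apply.
  by move=> h; exact: lt_le_trans h (fle _ _ _ ij).
rewrite /dyadic_sum -esup_mull//; last first.
  by move=> i; exact: sum_valuation_ge0.
congr (_ * _); rewrite big_map.
under eq_bigr => k _ do rewrite set_gt_esup (valuation_directed nu (dnet _)).
rewrite -(esup_sum _ dle).
- by apply: eq_esup => i; rewrite big_map.
- by move=> k i; exact: valuation_ge0.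
- move=> k i j ij; have [_ o h] := dnet (k.+1%:R / 2 ^+ n)%R.
  by apply: valuation_le (o _) (o _) _; exact: h.
Qed.

Lemma vint_indic (U : set X) : open U -> vint nu (fun x => (\1_U x)%:E) = nu U.
Proof.
move=> oU; have -> : (fun x => (\1_U x)%:E) = dyadic_simple R 0 [:: U] :> (X -> \bar R).
  by apply/funext => x; rewrite /dyadic_simple/= addn0 indicE divr1.
rewrite vint_dyadic_simple; first by rewrite /dyadic_sum big_seq1 expr0 invr1 mul1e.
by move=> W; rewrite inE => /eqP ->.
Qed.

(** On the approximating lists addition is concatenation, so the general case
    follows by passing to the supremum. *)
Lemma vint_add f g : lsc_nneg f -> lsc_nneg g ->
  vint nu (fun x => f x + g x) = vint nu f + vint nu g.
Proof.
move=> lf lg; have [f0 _] := lf; have [g0 _] := lg.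
have homo (k : X -> \bar R) m n : (m <= n)%N -> lsc_nneg k ->
    dyadic_sum nu m (dyadic_levels k m) <= dyadic_sum nu n (dyadic_levels k n).
  move=> mn lk; apply: dyadic_sum_le => [||x]; [exact: open_dyadic_levels..|].
  exact: (@dyadic_simple_levels_homo _ _ k x m n mn).
have sum_ge0 n s : 0 <= dyadic_sum nu n s.
  by rewrite mule_ge0 ?sum_valuation_ge0// lee_fin invr_ge0 exprn_ge0.
rewrite adde_dyadic// (vint_esup directed_leq); first last.
- move=> m n x mn; rewrite !dyadic_simple_cat.
  by apply: leeD; exact: (@dyadic_simple_levels_homo _ _ _ x m n mn).
- by move=> n; exact/dyadic_simple_lsc/open_dyadic_levels_cat.
rewrite !vint_dyadic// -(esup_add directed_leq)//.
- apply: eq_esup => n; rewrite vint_dyadic_simple ?dyadic_sum_cat//.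
  exact: open_dyadic_levels_cat.
- by move=> m n mn; exact: homo.
- by move=> m n mn; exact: homo.
Qed.

Lemma vint_scale_le (c : R) f : (0 < c)%R ->
  c%:E * vint nu f <= vint nu (fun x => c%:E * f x).
Proof.
move=> c0; rewrite -lee_pdivlMl//; apply: ge_ereal_sup => _ [n [r [U [r0 oU rf ->]]]].
rewrite lee_pdivlMl//; apply: ereal_sup_ubound.
exists n, (fun i => c%:E * r i), U; split => //.
- by move=> i; rewrite mule_gt0.
- move=> x; under eq_bigr do rewrite -muleA.
  rewrite -ge0_sume_distrr; last by move=> i _; rewrite mule_ge0 ?lee_fin// ltW.
  by rewrite lee_pmul2l.
- rewrite ge0_sume_distrr; last by move=> i _; rewrite mule_ge0 ?valuation_ge0// ltW.
  by under eq_bigr do rewrite muleA.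
Qed.

Lemma vint_scale (c : R) f : (0 < c)%R ->
  vint nu (fun x => c%:E * f x) = c%:E * vint nu f.
Proof.
move=> c0; apply/eqP; rewrite eq_le vint_scale_le// andbT.
rewrite -lee_pdivrMl//; apply: le_trans (vint_scale_le _ _) _; first by rewrite invr_gt0.
apply: vint_le => x; by rewrite muleA -EFinM mulVf ?mul1e// gt_eqF.
Qed.

Lemma vint0 : vint nu (fun=> 0) = 0.
Proof.
have -> : (fun=> 0) = (fun x => (\1_set0 x)%:E) :> (X -> \bar R).
  by apply/funext => x; rewrite indic0.
by rewrite vint_indic ?valuation0//; exact: open0.
Qed.

Lemma vint_sum (J : Type) (s : seq J) (f : J -> X -> \bar R) :
  (forall j, lsc_nneg (f j)) ->
  vint nu (fun x => \sum_(j <- s) f j x) = \sum_(j <- s) vint nu (f j).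
Proof.
move=> lf; elim: s => [|j s IH].
  have -> : (fun x => \sum_(j <- [::]) f j x) = (fun=> 0).
    by apply/funext => x; rewrite big_nil.
  by rewrite big_nil vint0.
have -> : (fun x => \sum_(j <- j :: s) f j x) =
    (fun x => f j x + \sum_(j <- s) f j x).
  by apply/funext => x; rewrite big_cons.
by rewrite big_cons vint_add// ?IH//; exact: lsc_nneg_sum.
Qed.

End vint_theory.

Lemma valuation_ext (R : realType) (X : topologicalType) (nu rho : valuation R X) :
  (forall g, lsc_nneg g -> vint nu g = vint rho g) -> nu = rho.
Proof.
by move=> h; apply: valuationP => U oU; rewrite -!vint_indic// h//; exact: lsc_nneg_indic.
Qed.

(** * The valuation monad *)

Section valuation_topology.
Variables (R : realType) (X : topologicalType).

Lemma open_vint_gt (g : X -> \bar R) (r : R) : lsc_nneg g ->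
  open [set nu : V R X | r%:E < vint nu g].
Proof.
move=> lg; exists [set [set nu : V R X | r%:E < vint nu g]]; last first.
  by rewrite bigcup_set1.
by move=> _ ->; apply: finI_from1; exists g, r.
Qed.

Lemma lsc_nneg_vint (g : X -> \bar R) : lsc_nneg g ->
  lsc_nneg (fun nu : V R X => vint nu g).
Proof.
move=> lg; split=> [nu|]; first by apply: vint_ge0; case: lg.
by apply/lower_semicontinuousP => r; exact: open_vint_gt.
Qed.

(** The pairings generate the topology, so continuity reduces to lower
    semicontinuity of each pairing. *)
Lemma continuous_valuation (Y : topologicalType) (h : Y -> V R X) :
  (forall g : X -> \bar R, lsc_nneg g ->
    lower_semicontinuous (fun y => vint (h y) g)) -> continuous h.
Proof.
move=> lh; apply/continuousP => _ [D sD <-]; rewrite preimage_bigcup.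
apply: bigcup_open => B /sD[E sE <-]; rewrite preimage_bigcap.
rewrite bigcap_fset big_seq; apply: (big_ind open) => [||C CE].
- exact: openT.
- exact: openI.
have /set_mem [g [r [lg ->]]] := sE _ CE.
by have /lower_semicontinuousP := lh _ lg; apply.
Qed.

End valuation_topology.

Lemma open_preimage (X Y : topologicalType) (f : continuousType X Y)
    (U : set Y) :
  open U -> open (f @^-1` U).
Proof. by have /continuousP := @cts_fun _ _ f; apply. Qed.

Lemma lsc_nneg_comp (R : realType) (X Y : topologicalType)
    (f : continuousType X Y) (g : Y -> \bar R) :
  lsc_nneg g -> lsc_nneg (g \o f).
Proof.
move=> [g0 /lower_semicontinuousP og]; split=> [x|]; first exact: g0.
apply/lower_semicontinuousP => r.
exact: (open_preimage f (og r)).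
Qed.

Section open_valuation.
Variables (R : realType) (X : topologicalType) (m : set X -> \bar R).
Hypothesis m_ge0 : forall U, open U -> 0 <= m U.
Hypothesis m0 : m set0 = 0.
Hypothesis m_modular : forall U W, open U -> open W ->
  m (U `|` W) + m (U `&` W) = m U + m W.
Hypothesis m_directed : forall (I : Type) (le : I -> I -> Prop) (U : I -> set X),
  directed_open_net le U ->
  m (\bigcup_i U i) = ereal_sup (range (fun i => m (U i))).

Let nopen U : ~ open U -> restrict_open m U = 0.
Proof. by rewrite /restrict_open => /asboolF ->. Qed.

Let ge0 U : 0 <= restrict_open m U.
Proof. by rewrite /restrict_open; case: asboolP => //; exact: m_ge0. Qed.

Let at0 : restrict_open m set0 = 0.
Proof. by rewrite (restrict_openE m open0). Qed.

Let modular U W : open U -> open W ->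
  restrict_open m (U `|` W) + restrict_open m (U `&` W) =
  restrict_open m U + restrict_open m W.
Proof.
by move=> oU oW; rewrite !restrict_openE ?m_modular//; [exact: openI|exact: openU].
Qed.

Let directed_sup (I : Type) (le : I -> I -> Prop) (U : I -> set X) :
  directed_open_net le U ->
  restrict_open m (\bigcup_i U i) =
  ereal_sup (range (fun i => restrict_open m (U i))).
Proof.
move=> dU; have [_ oU _] := dU; rewrite restrict_openE; last first.
  by apply: bigcup_open => i _; exact: oU.
by rewrite (m_directed dU); apply: eq_esup => i; rewrite restrict_openE.
Qed.

(** A valuation is determined by its values on open sets, so the constructions
    below specify only these, and the rest of the encoding is kept opaque. *)
Lemma open_valuation : {nu : V R X | forall U, open U -> nu U = m U}.
Proof.
exists (Valuation nopen ge0 at0 modular directed_sup) => U.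
exact: restrict_openE.
Qed.

End open_valuation.

Section image_valuation.
Variables (R : realType) (X Y : topologicalType) (f : continuousType X Y).

Section image.
Variable nu : V R X.

Let m (U : set Y) : \bar R := nu (f @^-1` U).

Let m_ge0 U : open U -> 0 <= m U. Proof. by move=> _; exact: valuation_ge0. Qed.

Let m0 : m set0 = 0. Proof. by rewrite /m preimage_set0 valuation0. Qed.

Let m_modular U W : open U -> open W -> m (U `|` W) + m (U `&` W) = m U + m W.
Proof.
move=> oU oW; rewrite /m preimage_setU preimage_setI.
by apply: valuation_modular; exact: open_preimage.
Qed.

Let m_directed (I : Type) (le : I -> I -> Prop) (U : I -> set Y) :
  directed_open_net le U ->
  m (\bigcup_i U i) = ereal_sup (range (fun i => m (U i))).
Proof.
move=> [dle oU Ule]; rewrite /m preimage_bigcup.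
rewrite (@valuation_directed _ _ nu I le)//.
by split => // [i|i j /Ule ij x]; [exact: open_preimage|exact: ij].
Qed.

Definition image_valuation : V R Y :=
  sval (open_valuation m_ge0 m0 m_modular m_directed).

Lemma image_valuationE (U : set Y) :
  open U -> image_valuation U = nu (f @^-1` U).
Proof.
exact: (svalP (open_valuation m_ge0 m0 m_modular m_directed)).
Qed.

Lemma vint_image g : lsc_nneg g -> vint image_valuation g = vint nu (g \o f).
Proof.
move=> lg; rewrite !vint_dyadic//; last exact: lsc_nneg_comp.
apply: eq_esup => n; congr (_ * _); rewrite !big_map.
apply: eq_bigr => k _; rewrite image_valuationE//.
by have [_ /lower_semicontinuousP] := lg; apply.
Qed.

End image.

Lemma image_valuation_continuous : continuous image_valuation.
Proof.
apply: continuous_valuation => g lg.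
have -> : (fun nu => vint (image_valuation nu) g) =
    (fun nu : V R X => vint nu (g \o f)).
  by apply/funext => nu; rewrite vint_image.
by have [] := lsc_nneg_vint (lsc_nneg_comp f lg).
Qed.

Definition valuation_map : continuousType (V R X) (V R Y) :=
  mkcts image_valuation_continuous.

End image_valuation.

Section dirac_valuation.
Variables (R : realType) (X : topologicalType).

Section dirac.
Variable x : X.

Let m (U : set X) : \bar R := (\1_U x)%:E.

Let m_ge0 U : open U -> 0 <= m U. Proof. by rewrite lee_fin. Qed.

Let m0 : m set0 = 0. Proof. by rewrite /m indic0. Qed.

Let m_modular U W : open U -> open W -> m (U `|` W) + m (U `&` W) = m U + m W.
Proof.
move=> oU oW; rewrite /m -!EFinD !indicE in_setU in_setI.
by case: (x \in U); case: (x \in W); rewrite /= ?addr0 ?add0r.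
Qed.

Let m_directed (I : Type) (le : I -> I -> Prop) (U : I -> set X) :
  directed_open_net le U ->
  m (\bigcup_i U i) = ereal_sup (range (fun i => m (U i))).
Proof.
move=> [[[i0] _ _ _] _ _].
apply/esym/eqP; rewrite eq_le; apply/andP; split.
  apply: esup_le => i; rewrite lee_fin !indicE ler_nat.
  by case: (boolP (x \in U i)) => // /set_mem Ux; rewrite mem_set//; exists i.
rewrite {1}/m indicE; case: (boolP (x \in _)) => [/set_mem[i _ Ux]|_].
  apply: (le_trans _ (esup_ge (fun i => m (U i)) i)).
  by rewrite /m indicE mem_set.
by apply: (le_trans _ (esup_ge (fun i => m (U i)) i0)); rewrite lee_fin.
Qed.

Definition dirac_at : V R X :=
  sval (open_valuation m_ge0 m0 m_modular m_directed).

Lemma dirac_atE (U : set X) : open U -> dirac_at U = (\1_U x)%:E.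
Proof.
exact: (svalP (open_valuation m_ge0 m0 m_modular m_directed)).
Qed.

Lemma vint_dirac g : lsc_nneg g -> vint dirac_at g = g x.
Proof.
move=> lg; have [g0 _] := lg; rewrite vint_dyadic// -[RHS]esup_dyadic_simple//.
apply: eq_esup => n; rewrite dyadic_simple_sum -ge0_sume_distrr//.
congr (_ * _); apply: eq_big_seq => U Un; rewrite dirac_atE//.
exact: open_dyadic_levels Un.
Qed.

End dirac.

Lemma dirac_at_continuous : continuous dirac_at.
Proof.
apply: continuous_valuation => g lg.
have -> : (fun x => vint (dirac_at x) g) = g.
  by apply/funext => x; rewrite vint_dirac.
by case: lg.
Qed.

Definition valuation_dirac : continuousType X (V R X) :=
  mkcts dirac_at_continuous.

End dirac_valuation.

Lemma lsc_nneg_eval (R : realType) (X : topologicalType) (U : set X) :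
  open U -> lsc_nneg (fun rho : V R X => rho U).
Proof.
move=> oU; have -> : (fun rho : V R X => rho U) =
    (fun rho : V R X => vint rho (fun x => (\1_U x)%:E)).
  by apply/funext => rho; rewrite vint_indic.
exact/lsc_nneg_vint/lsc_nneg_indic.
Qed.

Section flatten_valuation.
Variables (R : realType) (X : topologicalType).

Section at_valuation.
Variable xi : V R (V R X).

Let m (U : set X) : \bar R := vint xi (fun rho : V R X => rho U).

Let m_ge0 U : open U -> 0 <= m U.
Proof. by move=> _; apply: vint_ge0 => rho; exact: valuation_ge0. Qed.

Let m0 : m set0 = 0.
Proof.
rewrite -[RHS](vint0 xi); congr (vint _ _).
by apply/funext => rho; rewrite valuation0.
Qed.

Let m_modular U W : open U -> open W -> m (U `|` W) + m (U `&` W) = m U + m W.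
Proof.
move=> oU oW; have oUW := openU oU oW; have oI := openI oU oW.
rewrite /m -!vint_add; try exact: lsc_nneg_eval.
by congr (vint _ _); apply/funext => rho; rewrite valuation_modular.
Qed.

Let m_directed (I : Type) (le : I -> I -> Prop) (U : I -> set X) :
  directed_open_net le U ->
  m (\bigcup_i U i) = ereal_sup (range (fun i => m (U i))).
Proof.
move=> dU; have [dle oU Ule] := dU; rewrite -(vint_esup _ dle).
- by congr (vint _ _); apply/funext => rho; rewrite (valuation_directed rho dU).
- by move=> i; exact: lsc_nneg_eval.
- by move=> i j rho /Ule; exact: valuation_le.
Qed.

Definition flatten_valuation : V R X :=
  sval (open_valuation m_ge0 m0 m_modular m_directed).

Lemma flatten_valuationE (U : set X) :
  open U -> flatten_valuation U = vint xi (fun rho : V R X => rho U).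
Proof.
exact: (svalP (open_valuation m_ge0 m0 m_modular m_directed)).
Qed.

(** By definition the two sides agree on indicators of open sets.  They agree on
    dyadic sums by linearity of the pairing with [xi], and on every [g] by its
    Scott-continuity. *)
Lemma vint_flatten g : lsc_nneg g ->
  vint flatten_valuation g = vint xi (fun rho : V R X => vint rho g).
Proof.
move=> lg; rewrite vint_dyadic//.
have -> : (fun rho : V R X => vint rho g) = (fun rho : V R X =>
    esup (fun n => dyadic_sum rho n (dyadic_levels g n))).
  by apply/funext => rho; rewrite vint_dyadic.
have oL n : open_list (dyadic_levels g n) by exact: open_dyadic_levels.
pose F n k := fun rho : V R X => rho [set x | (k.+1%:R / 2 ^+ n)%:E < g x].
have lF n k : lsc_nneg (F n k).
  by apply: lsc_nneg_eval; have [_ /lower_semicontinuousP] := lg; apply.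
have sumE n : (fun rho : V R X => dyadic_sum rho n (dyadic_levels g n)) =
    (fun rho => (2 ^- n)%:E * \sum_(k <- iota 0 (n * 2 ^ n)) F n k rho).
  by apply/funext => rho; rewrite /dyadic_sum big_map.
have n0 n : (0 < 2 ^- n :> R)%R by rewrite invr_gt0 exprn_gt0.
rewrite (vint_esup _ directed_leq).
- apply: eq_esup => n; rewrite sumE vint_scale// vint_sum//.
  rewrite /dyadic_sum big_map; congr (_ * _); apply: eq_bigr => k _.
  by rewrite flatten_valuationE//; have [_ /lower_semicontinuousP] := lg; apply.
- by move=> n; rewrite sumE; apply: lsc_nneg_scale => //; exact: lsc_nneg_sum.
- move=> m' n rho mn; apply: dyadic_sum_le => // x.
  exact: (@dyadic_simple_levels_homo _ _ g x m' n mn).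
Qed.

End at_valuation.

Lemma flatten_valuation_continuous : continuous flatten_valuation.
Proof.
apply: continuous_valuation => g lg.
have -> : (fun xi => vint (flatten_valuation xi) g) =
    (fun xi : V R (V R X) => vint xi (fun rho : V R X => vint rho g)).
  by apply/funext => xi; rewrite vint_flatten.
by have [] := lsc_nneg_vint (lsc_nneg_vint lg).
Qed.

Definition valuation_flatten : continuousType (V R (V R X)) (V R X) :=
  mkcts flatten_valuation_continuous.

End flatten_valuation.

Section valuation_monad.
Variable R : realType.

Lemma valuation_map_id (X : topologicalType) :
  valuation_map R (idfun : continuousType X X) =1 idfun.
Proof. by move=> nu; apply: valuation_ext => g lg; rewrite vint_image. Qed.

Lemma valuation_map_comp (X Y Z : topologicalType)
    (f : continuousType X Y) (g : continuousType Y Z) :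
  valuation_map R (g \o f : continuousType X Z) =1
  valuation_map R g \o valuation_map R f.
Proof.
move=> nu; apply: valuation_ext => h lh /=.
by rewrite !vint_image//; exact: lsc_nneg_comp.
Qed.

Lemma valuation_dirac_natural (X Y : topologicalType) (f : continuousType X Y) :
  valuation_map R f \o valuation_dirac R X =1 valuation_dirac R Y \o f.
Proof.
move=> x; apply: valuation_ext => g lg /=.
by rewrite vint_image// !vint_dirac//; exact: lsc_nneg_comp.
Qed.

Lemma valuation_flatten_natural (X Y : topologicalType) (f : continuousType X Y) :
  valuation_map R f \o valuation_flatten R X =1
  valuation_flatten R Y \o valuation_map R (valuation_map R f).
Proof.
move=> xi; apply: valuation_ext => g lg /=.
have lgf := lsc_nneg_comp f lg.
rewrite vint_image// !vint_flatten// vint_image; last exact: lsc_nneg_vint.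
by congr (vint _ _); apply/funext => nu /=; rewrite vint_image.
Qed.

Lemma valuation_flatten_dirac (X : topologicalType) :
  valuation_flatten R X \o valuation_dirac R (V R X) =1 idfun.
Proof.
move=> nu; apply: valuation_ext => g lg /=.
by rewrite vint_flatten// vint_dirac//; exact: lsc_nneg_vint.
Qed.

Lemma valuation_flatten_map_dirac (X : topologicalType) :
  valuation_flatten R X \o valuation_map R (valuation_dirac R X) =1 idfun.
Proof.
move=> nu; apply: valuation_ext => g lg /=.
rewrite vint_flatten// vint_image; last exact: lsc_nneg_vint.
by congr (vint _ _); apply/funext => x /=; rewrite vint_dirac.
Qed.

Lemma valuation_flatten_flatten (X : topologicalType) :
  valuation_flatten R X \o valuation_flatten R (V R X) =1
  valuation_flatten R X \o valuation_map R (valuation_flatten R X).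
Proof.
move=> Xi; apply: valuation_ext => g lg /=; have lvg := lsc_nneg_vint lg.
rewrite !vint_flatten// vint_image//.
by congr (vint _ _); apply/funext => xi /=; rewrite vint_flatten.
Qed.

Definition valuation_monad : monad (V R) := Monad
  valuation_map_id valuation_map_comp valuation_dirac_natural
  valuation_flatten_natural valuation_flatten_dirac valuation_flatten_map_dirac
  valuation_flatten_flatten.

Lemma valuation_monadP : valuation_monad_data valuation_monad.
Proof.
split => [X Y f nu U oU|X x U oU|X xi g lg] /=.
- exact: image_valuationE.
- exact: dirac_atE.
- exact: vint_flatten.
Qed.

End valuation_monad.

(** * Tau-smooth probabilities as measures *)

(** Integration is defined for bundled measures on a pointed type; the map [p]
    itself is such a measure, whichever point is chosen. *)
Section tau_measure.
Variables (R : realType) (X : topologicalType) (p : P R X) (x0 : X).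

Let m : set (borelType x0) -> \bar R := p.

Let m0 : m set0 = 0.
Proof.
have [y0 [q qE]] := tau_borel_probability p.
by rewrite /m qE; [exact: measure0|exact: (open_borel_set open0)].
Qed.

Let m_ge0 A : 0 <= m A.
Proof.
have [bA|nbA] := pselect (borel_set (A : set X)); last by rewrite /m tau_nborel.
by have [y0 [q qE]] := tau_borel_probability p; rewrite /m qE.
Qed.

Let m_semi_sigma_additive : semi_sigma_additive m.
Proof.
move=> F mF tF mUF; have [y0 [q qE]] := tau_borel_probability p.
rewrite /m qE//.
have -> : (fun n => \sum_(0 <= i < n) tau_fun p (F i)) =
    (fun n => \sum_(0 <= i < n) q (F i)).
  by apply/funext => n; apply: eq_bigr => i _; rewrite qE//; exact: mF.
exact: (measure_semi_sigma_additive (s := q)).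
Qed.

HB.instance Definition _ := isMeasure.Build _ _ _ m
  m0 m_ge0 m_semi_sigma_additive.

Let m_setT : m [set: borelType x0] = 1.
Proof.
have [y0 [q qE]] := tau_borel_probability p.
by rewrite /m qE; [exact: probability_setT|exact: (open_borel_set openT)].
Qed.

HB.instance Definition _ := Measure_isProbability.Build _ _ _ m m_setT.

Definition tau_measure : probability (borelType x0) R := m.

End tau_measure.

Lemma lsc_measurable (R : realType) (X : topologicalType) (x0 : X)
    (g : X -> \bar R) :
  lsc_nneg g -> measurable_fun [set: borelType x0] g.
Proof.
move=> [_ /lower_semicontinuousP og].
apply: (measurability _ (ErealGenOInfty.measurableE R)).
move=> /= _ [_ [a ->]] <-; rewrite setTI; apply: open_borel_set.
by rewrite preimage_itvoy; exact: og.
Qed.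

(** Both sides are the limit of the sums [dyadic_sum], by monotone convergence on
    the left and by [vint_dyadic] on the right. *)
Lemma integral_lsc (R : realType) (X : topologicalType) (p : P R X) (x0 : X)
    (g : X -> \bar R) :
  lsc_nneg g -> \int[tau_measure p x0]_x g x = vint (inclusion R X p) g.
Proof.
move=> lg; have [g0 _] := lg.
pose h n := dyadic_simple R n (dyadic_levels g n) : X -> \bar R.
pose L n k : set X := [set x | (k.+1%:R / 2 ^+ n)%:E < g x].
have oL n k : open (L n k).
  by have [_ /lower_semicontinuousP] := lg; apply.
have lh n : lsc_nneg (h n).
  by apply: dyadic_simple_lsc; exact: open_dyadic_levels.
have hle x : {homo h^~ x : m n / (m <= n)%N >-> m <= n}.
  exact: dyadic_simple_levels_homo.
have gE x : g x = limn (h^~ x).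
  rewrite -[LHS]esup_dyadic_simple//; apply/esym/cvg_lim => //.
  by apply: ereal_nondecreasing_cvgn => m n; exact: hle.
transitivity (\int[tau_measure p x0]_x limn (h^~ x)).
  by apply: eq_integral => x _; exact: gE.
have mh n : measurable_fun [set: borelType x0] (h n) by exact: lsc_measurable.
rewrite monotone_convergence//; last by move=> n x _; exact: dyadic_simple_ge0.
rewrite vint_dyadic//.
have -> : (fun n => \int[tau_measure p x0]_x h n x) =
    (fun n => dyadic_sum (inclusion R X p) n (dyadic_levels g n)).
  apply/funext => n.
  transitivity (\int[tau_measure p x0]_x \sum_(k <- iota 0 (n * 2 ^ n))
      ((2 ^- n)%:E * (\1_(L n k) x)%:E)).
    apply: eq_integral => x _; by rewrite /h dyadic_simple_sum big_map.
  have mL k : measurable_fun [set: borelType x0] (fun x => (\1_(L n k) x)%:E : \bar R).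
    by apply: lsc_measurable; exact: lsc_nneg_indic.
  have m2L k : measurable_fun [set: borelType x0]
      (fun x => (2 ^- n)%:E * (\1_(L n k) x)%:E : \bar R).
    exact: measurable_funeM.
  rewrite ge0_integral_sum//.
  rewrite /dyadic_sum big_map ge0_sume_distrr; last first.
    by move=> k _; exact: valuation_ge0.
  apply: eq_bigr => k _; rewrite ge0_integralZl_EFin// integral_indic//.
    by rewrite setIT /= -/(L n k) restrict_openE.
  exact: open_borel_set.
apply/cvg_lim => //; apply: ereal_nondecreasing_cvgn => m n mn.
apply: dyadic_sum_le => [||x]; [exact: open_dyadic_levels..|].
exact: (@dyadic_simple_levels_homo _ _ g x m n mn).
Qed.

Section of_measure.
Variables (R : realType) (X : topologicalType) (x0 : X).
Variable m : probability (borelType x0) R.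
Hypothesis m_smooth : forall (I : Type) (le : I -> I -> Prop) (U : I -> set X),
  directed_open_net le U ->
  m (\bigcup_i U i) = ereal_sup (range (fun i => m (U i))).

Definition borel_fun (A : set X) : \bar R :=
  if `[< borel_set A >] then m A else 0.

Lemma borel_funE A : borel_set A -> borel_fun A = m A.
Proof. by rewrite /borel_fun => /asboolT ->. Qed.

Lemma borel_fun_nborel A : ~ borel_set A -> borel_fun A = 0.
Proof. by rewrite /borel_fun => /asboolF ->. Qed.

Lemma borel_fun_probability : borel_probability borel_fun.
Proof. by exists x0, m; exact: borel_funE. Qed.

Lemma borel_fun_smooth (I : Type) (le : I -> I -> Prop) (U : I -> set X) :
  directed_open_net le U ->
  borel_fun (\bigcup_i U i) = ereal_sup (range (fun i => borel_fun (U i))).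
Proof.
move=> dU; have [_ oU _] := dU.
rewrite borel_funE; last first.
  by apply: open_borel_set; apply: bigcup_open => i _; exact: oU.
rewrite (m_smooth dU); apply: eq_esup => i.
by rewrite borel_funE//; exact: open_borel_set.
Qed.

Definition tau_of_measure : P R X :=
  TauProbability borel_fun_nborel borel_fun_probability borel_fun_smooth.

End of_measure.

(** A space that carries a probability is inhabited, so the measures built from
    [p] can be based at this point. *)
Definition tau_point (R : realType) (X : topologicalType) (p : P R X) : X :=
  sval (cid (tau_borel_probability p)).

Lemma borel_preimage (X Y : topologicalType) (f : continuousType X Y)
    (B : set Y) : borel_set B -> borel_set (f @^-1` B).
Proof.
suff : borel_set (X := Y) `<=` [set A | borel_set (f @^-1` A)] by exact.
apply: smallest_sub.
  have [h0 hC hU] := @smallest_sigma_algebra X setT open.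
  split => [|C|F hF] /=.
  - by rewrite preimage_set0.
  - by rewrite !setTD preimage_setC -setTD; exact: hC.
  - by rewrite preimage_bigcup; exact: hU.
by move=> U /(open_preimage f) /open_borel_set.
Qed.

(** * The structure maps of the probability monad *)

Lemma continuous_tau (R : realType) (X Y : topologicalType) (h : Y -> P R X) :
  continuous (inclusion R X \o h) -> continuous h.
Proof. exact: (@continuous_comp_initial _ _ _ (@inclusion_fun R X)). Qed.

Section tau_image.
Variables (R : realType) (X Y : topologicalType) (f : continuousType X Y).

Section measure.
Variable p : P R X.

Let x0 := tau_point p.

Let m : set (borelType (f x0)) -> \bar R := fun B => p (f @^-1` B).

Let m0 : m set0 = 0.
Proof. by rewrite /m preimage_set0; exact: (measure0 (tau_measure p x0)). Qed.

Let m_ge0 B : 0 <= m B. Proof. exact: (measure_ge0 (tau_measure p x0)). Qed.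

Let m_semi_sigma_additive : semi_sigma_additive m.
Proof.
move=> F mF tF mUF; rewrite /m preimage_bigcup.
apply: (measure_semi_sigma_additive (s := tau_measure p x0)).
- by move=> n; exact: (borel_preimage f (mF n)).
- apply/trivIsetP => /= i j _ _ ij; rewrite -preimage_setI.
  by move/trivIsetP : tF => /(_ _ _ _ _ ij) ->//; rewrite preimage_set0.
- by rewrite -preimage_bigcup; exact: (borel_preimage f mUF).
Qed.

HB.instance Definition _ := isMeasure.Build _ _ _ m
  m0 m_ge0 m_semi_sigma_additive.

Let m_setT : m [set: borelType (f x0)] = 1.
Proof. exact: (probability_setT (tau_measure p x0)). Qed.

HB.instance Definition _ := Measure_isProbability.Build _ _ _ m m_setT.

Let m_smooth (I : Type) (le : I -> I -> Prop) (U : I -> set Y) :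
  directed_open_net le U ->
  m (\bigcup_i U i) = ereal_sup (range (fun i => m (U i))).
Proof.
move=> [dle oU Ule]; rewrite /m preimage_bigcup.
rewrite (@tau_smooth _ _ p I le)//; split => // [i|i j /Ule ij x].
  exact: open_preimage.
exact: ij.
Qed.

Definition tau_image : P R Y :=
  tau_of_measure (m := (m : probability (borelType (f x0)) R)) m_smooth.

Lemma tau_imageE (B : set Y) : borel_set B -> tau_image B = p (f @^-1` B).
Proof. exact: borel_funE. Qed.

Lemma inclusion_tau_image :
  inclusion R Y tau_image = valuation_map R f (inclusion R X p).
Proof.
apply: valuationP => U oU; rewrite /= restrict_openE// image_valuationE//=.
rewrite restrict_openE; last exact: open_preimage.
by apply: borel_funE; exact: open_borel_set.
Qed.

End measure.

Lemma tau_image_continuous : continuous tau_image.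
Proof.
apply: continuous_tau.
have -> : inclusion R Y \o tau_image = valuation_map R f \o inclusion R X.
  by apply/funext => p; exact: inclusion_tau_image.
exact: cts_fun.
Qed.

Definition tau_map : continuousType (P R X) (P R Y) := mkcts tau_image_continuous.

End tau_image.

Section tau_unit.
Variables (R : realType) (X : topologicalType).

Section dirac.
Variable x : X.

Let d : probability (borelType x) R := \d_(x : borelType x).

Let dE (U : set X) : open U -> d U = valuation_dirac R X x U.
Proof. by move=> oU; rewrite dirac_atE. Qed.

Let d_smooth (I : Type) (le : I -> I -> Prop) (U : I -> set X) :
  directed_open_net le U ->
  d (\bigcup_i U i) = ereal_sup (range (fun i => d (U i))).
Proof.
move=> dU; have [_ oU _] := dU; rewrite dE; last first.
  by apply: bigcup_open => i _; exact: oU.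
rewrite (valuation_directed (valuation_dirac R X x) dU).
by apply: eq_esup => i; rewrite dE.
Qed.

Definition tau_dirac_at : P R X := tau_of_measure d_smooth.

Lemma tau_dirac_atE (A : set X) :
  borel_set A -> tau_dirac_at A = \d_(x : borelType x) A.
Proof. exact: borel_funE. Qed.

Lemma inclusion_tau_dirac : inclusion R X tau_dirac_at = valuation_dirac R X x.
Proof.
apply: valuationP => U oU; rewrite /= restrict_openE// -dE//.
exact: (borel_funE _ (open_borel_set oU)).
Qed.

End dirac.

Lemma tau_dirac_continuous : continuous tau_dirac_at.
Proof.
apply: continuous_tau.
have -> : inclusion R X \o tau_dirac_at = valuation_dirac R X.
  by apply/funext => x; exact: inclusion_tau_dirac.
exact: cts_fun.
Qed.

Definition tau_dirac : continuousType X (P R X) := mkcts tau_dirac_continuous.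

End tau_unit.

Section tau_eval.
Variables (R : realType) (X : topologicalType).

Lemma lsc_nneg_tau_eval (U : set X) : open U -> lsc_nneg (fun p : P R X => p U).
Proof.
move=> oU.
have -> : (fun p : P R X => p U) = (fun rho : V R X => rho U) \o inclusion R X.
  by apply/funext => p /=; rewrite restrict_openE.
exact: (lsc_nneg_comp (inclusion R X) (lsc_nneg_eval R oU)).
Qed.

(** Evaluation at an open set is lower semicontinuous; the Borel sets at which
    evaluation is measurable form a Dynkin system. *)
Lemma measurable_tau_eval (p0 : P R X) (A : set X) : borel_set A ->
  measurable_fun [set: borelType p0] (fun p : P R X => p A).
Proof.
pose x0 := tau_point p0.
apply: (@dynkin_induction _ (borelType x0) open
  [set A | measurable_fun [set: borelType p0] (fun p : P R X => p A)]) => //=.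
- exact: openI.
- have -> : (fun p : P R X => p [set: X]) = cst 1.
    by apply/funext => p; exact: (probability_setT (tau_measure p x0)).
  exact: measurable_cst.
- by move=> U oU; apply: lsc_measurable; exact: lsc_nneg_tau_eval.
- move=> S mS hS.
  have -> : (fun p : P R X => p (~` S)) = cst 1 \- (fun p : P R X => p S).
    by apply/funext => p; exact: (probability_setC (tau_measure p x0)).
  exact: (@emeasurable_funB _ (borelType p0) R setT (cst 1) (fun p : P R X => p S)
    (measurable_cst _) hS).
- move=> F mF tF hF.
  have -> : (fun p : P R X => p (\bigcup_k F k)) =
      (fun p : P R X => \sum_(k <oo) p (F k)).
    apply/funext => p; apply/esym/cvg_lim => //.
    exact: (measure_sigma_additive (mu := tau_measure p x0)).
  apply: (@ge0_emeasurable_sum _ (borelType p0) R setT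
    (fun k (p : P R X) => p (F k)) xpredT).
  + by move=> k p _ _; exact: (measure_ge0 (tau_measure p x0)).
  + by move=> k _; exact: hF.
Qed.

End tau_eval.

Section tau_mult.
Variables (R : realType) (X : topologicalType).

Section at_point.
Variables (mu : P R (P R X)) (p0 : P R X).

Let x0 := tau_point p0.

Let m : set (borelType x0) -> \bar R :=
  fun A => \int[tau_measure mu p0]_p (p : P R X) A.

Let eval_ge0 (p : P R X) (A : set X) : 0 <= p A.
Proof. exact: (measure_ge0 (tau_measure p x0)). Qed.

Let m0 : m set0 = 0.
Proof.
by rewrite /m integral0_eq// => p _; exact: (measure0 (tau_measure p x0)).
Qed.

Let m_ge0 A : 0 <= m A. Proof. exact: integral_ge0. Qed.

Let m_semi_sigma_additive : semi_sigma_additive m.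
Proof.
move=> F mF tF _; have mev k := @measurable_tau_eval R X p0 _ (mF k).
rewrite [X in _ --> X](_ : _ =
    \int[tau_measure mu p0]_p \sum_(0 <= k <oo) (p : P R X) (F k)); last first.
  apply: eq_integral => p _; apply/esym/cvg_lim => //.
  exact: (measure_sigma_additive (mu := tau_measure p x0)).
rewrite [X in X @ _](_ : _ =
    (fun n => \int[tau_measure mu p0]_p \sum_(0 <= i < n) (p : P R X) (F i)));
  last first.
  by apply/funext => n; rewrite -ge0_integral_sum.
apply: cvg_monotone_convergence => //.
- by move=> n; apply: emeasurable_sum => k; exact: mev.
- by move=> n p _; rewrite sume_ge0.
- by move=> p _ a b ab; apply: ereal_nondecreasing_series.
Qed.

HB.instance Definition _ := isMeasure.Build _ _ _ m
  m0 m_ge0 m_semi_sigma_additive.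

Let m_setT : m [set: borelType x0] = 1.
Proof.
rewrite -[RHS](probability_setT (tau_measure mu p0)) -[RHS]mul1e.
rewrite -integral_cst//; apply: eq_integral => p _.
exact: (probability_setT (tau_measure p x0)).
Qed.

HB.instance Definition _ := Measure_isProbability.Build _ _ _ m m_setT.

(* Tau-smoothness of the average comes from Scott-continuity of this pairing. *)
Let mE (U : set X) : open U ->
  m U = vint (inclusion R (P R X) mu) (fun p : P R X => p U).
Proof. by move=> oU; apply: integral_lsc; exact: lsc_nneg_tau_eval. Qed.

Let m_smooth (I : Type) (le : I -> I -> Prop) (U : I -> set X) :
  directed_open_net le U ->
  m (\bigcup_i U i) = ereal_sup (range (fun i => m (U i))).
Proof.
move=> dU; have [dle oU Ule] := dU.
rewrite mE; last by apply: bigcup_open => i _; exact: oU.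
have -> : (fun p : P R X => p (\bigcup_i U i)) =
    (fun p : P R X => esup (fun i => p (U i))).
  by apply/funext => p; exact: tau_smooth dU.
rewrite (vint_esup _ dle).
- by apply: eq_esup => i; rewrite mE.
- by move=> i; exact: lsc_nneg_tau_eval.
- move=> i j p /Ule Uij.
  by apply: (le_measure (tau_measure p x0)); rewrite ?inE//; exact: open_borel_set.
Qed.

Definition tau_flatten_at : P R X :=
  tau_of_measure (m := (m : probability (borelType x0) R)) m_smooth.

Lemma tau_flatten_atE (A : set X) : borel_set A ->
  tau_flatten_at A = \int[(mu : set (borelType p0) -> \bar R)]_p (p : P R X) A.
Proof. exact: borel_funE. Qed.

Lemma inclusion_tau_flatten_at : inclusion R X tau_flatten_at =
  valuation_flatten R X (valuation_map R (inclusion R X) (inclusion R (P R X) mu)).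
Proof.
apply: valuationP => U oU; rewrite /= restrict_openE// flatten_valuationE//.
rewrite vint_image; last exact: lsc_nneg_eval.
transitivity (m U); first by apply: borel_funE; exact: open_borel_set.
by rewrite mE//; congr (vint _ _); apply/funext => p /=; rewrite restrict_openE.
Qed.

End at_point.

Definition tau_flatten_fun (mu : P R (P R X)) : P R X :=
  tau_flatten_at mu (tau_point mu).

Lemma inclusion_tau_flatten mu : inclusion R X (tau_flatten_fun mu) =
  valuation_flatten R X (valuation_map R (inclusion R X) (inclusion R (P R X) mu)).
Proof. exact: inclusion_tau_flatten_at. Qed.

(** The averages formed at two different points agree on open sets, where they
    are pairings, hence they are equal. *)
Lemma tau_flatten_funE mu p0 (A : set X) : borel_set A ->
  tau_flatten_fun mu A =
  \int[(mu : set (borelType p0) -> \bar R)]_p (p : P R X) A.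
Proof.
move=> bA; rewrite -tau_flatten_atE//; congr (tau_fun _ A).
by apply: inclusion_injective; rewrite !inclusion_tau_flatten_at.
Qed.

Lemma tau_flatten_continuous : continuous tau_flatten_fun.
Proof.
apply: continuous_tau.
have -> : inclusion R X \o tau_flatten_fun = valuation_flatten R X \o
    (valuation_map R (inclusion R X) \o inclusion R (P R X)).
  by apply/funext => mu; exact: inclusion_tau_flatten.
exact: cts_fun.
Qed.

Definition tau_flatten : continuousType (P R (P R X)) (P R X) :=
  mkcts tau_flatten_continuous.

End tau_mult.

(** * The probability monad and the inclusion *)

Section probability_monad.
Variable R : realType.

Lemma valuation_map_eq (X Y : topologicalType) (f g : continuousType X Y) :
  f =1 g -> valuation_map R f =1 valuation_map R g.
Proof. by move=> /continuousEP ->. Qed.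

Lemma valuation_map_square (X Y Y' Z : topologicalType)
    (f : continuousType X Y) (g : continuousType Y Z)
    (f' : continuousType X Y') (g' : continuousType Y' Z) :
  g \o f =1 g' \o f' ->
  valuation_map R g \o valuation_map R f =1
  valuation_map R g' \o valuation_map R f'.
Proof.
move=> e nu; rewrite -!valuation_map_comp; exact: valuation_map_eq.
Qed.

Lemma tau_map_id (X : topologicalType) :
  tau_map R (idfun : continuousType X X) =1 idfun.
Proof.
by move=> p; apply: inclusion_injective; rewrite inclusion_tau_image valuation_map_id.
Qed.

Lemma tau_map_comp (X Y Z : topologicalType)
    (f : continuousType X Y) (g : continuousType Y Z) :
  tau_map R (g \o f : continuousType X Z) =1 tau_map R g \o tau_map R f.
Proof.
move=> p; apply: inclusion_injective.
by rewrite !inclusion_tau_image valuation_map_comp.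
Qed.

Lemma tau_dirac_natural (X Y : topologicalType) (f : continuousType X Y) :
  tau_map R f \o tau_dirac R X =1 tau_dirac R Y \o f.
Proof.
move=> x; apply: inclusion_injective => /=.
rewrite inclusion_tau_image !inclusion_tau_dirac.
exact: valuation_dirac_natural.
Qed.

Lemma tau_flatten_natural (X Y : topologicalType) (f : continuousType X Y) :
  tau_map R f \o tau_flatten R X =1 tau_flatten R Y \o tau_map R (tau_map R f).
Proof.
move=> mu; apply: inclusion_injective => /=.
rewrite inclusion_tau_image !inclusion_tau_flatten inclusion_tau_image.
apply: etrans (valuation_flatten_natural f _) _; congr (valuation_flatten R Y _).
apply: valuation_map_square => p.
by rewrite /= inclusion_tau_image.
Qed.

Lemma tau_flatten_dirac (X : topologicalType) :
  tau_flatten R X \o tau_dirac R (P R X) =1 idfun.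
Proof.
move=> p; apply: inclusion_injective => /=.
rewrite inclusion_tau_flatten inclusion_tau_dirac.
apply: etrans (valuation_flatten_dirac _); congr (valuation_flatten R X _).
exact: (valuation_dirac_natural R (inclusion R X)).
Qed.

Lemma tau_flatten_map_dirac (X : topologicalType) :
  tau_flatten R X \o tau_map R (tau_dirac R X) =1 idfun.
Proof.
move=> p; apply: inclusion_injective => /=.
rewrite inclusion_tau_flatten inclusion_tau_image.
apply: etrans (valuation_flatten_map_dirac _); congr (valuation_flatten R X _).
apply: etrans (esym (valuation_map_comp _ _ _)) _.
by apply: valuation_map_eq => x; exact: inclusion_tau_dirac.
Qed.

(** In the valuation monad, naturality and associativity of flattening bring the
    two sides to the form [valuation_flatten R X] of two images of [M]; these
    agree by functoriality and [inclusion_tau_flatten]. *)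
Lemma tau_flatten_flatten (X : topologicalType) :
  tau_flatten R X \o tau_flatten R (P R X) =1
  tau_flatten R X \o tau_map R (tau_flatten R X).
Proof.
move=> M; apply: inclusion_injective => /=.
rewrite !inclusion_tau_flatten inclusion_tau_image.
pose i := inclusion R X; pose Vi := valuation_map R i.
transitivity (valuation_flatten R X (valuation_flatten R (V R X)
    (valuation_map R Vi (valuation_map R (inclusion R (P R X))
      (inclusion R (P R (P R X)) M))))).
  congr (valuation_flatten R X _); exact: (valuation_flatten_natural i).
apply: etrans (valuation_flatten_flatten _) _; congr (valuation_flatten R X _) => /=.
transitivity (valuation_map R (valuation_flatten R X)
    (valuation_map R (Vi \o inclusion R (P R X)) (inclusion R (P R (P R X)) M))).
  by congr (valuation_map R _ _); rewrite valuation_map_comp.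
apply: valuation_map_square => mu; exact/esym/inclusion_tau_flatten.
Qed.

Definition probability_monad : monad (P R) := Monad
  tau_map_id tau_map_comp tau_dirac_natural tau_flatten_natural
  tau_flatten_dirac tau_flatten_map_dirac tau_flatten_flatten.

Lemma probability_monadP : probability_monad_data probability_monad.
Proof.
split => [X Y f p B bB|X x A bA|X mu A bA p0] /=.
- exact: tau_imageE.
- exact: tau_dirac_atE.
- exact: tau_flatten_funE.
Qed.

Lemma inclusion_monad_morphism :
  monad_morphism probability_monad (valuation_monad R) (inclusion R).
Proof.
split => [X Y f p|X x|X mu] /=.
- exact: inclusion_tau_image.
- exact: inclusion_tau_dirac.
- exact: inclusion_tau_flatten.
Qed.

End probability_monad.

Theorem theorem4p14 (R : realType) :
  exists (MP : monad (P R)) (MV : monad (V R)),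
    [/\ probability_monad_data MP,
        valuation_monad_data MV &
        monad_morphism MP MV (inclusion R)].
Proof.
exists (probability_monad R), (valuation_monad R); split.
- exact: probability_monadP.
- exact: valuation_monadP.
- exact: inclusion_monad_morphism.
Qed.
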